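(* Let $\varphi:[0,\pi]\to\mathbb{R}_+$ be twice continuously differentiable and increasing on $[0,\pi]$, with $\varphi'>0$ on $(0,\pi)$, and such that $0$ is an entrance boundary for the diffusion $$dX(t)=\sqrt{2}\,dB(t)+\frac{1}{\varphi'(X(t))}\,dt .$$ Start this diffusion at $X(0)=0$ and let $\tau$ be its hitting time of $\pi$. Assume that $\max_{[0,\pi]}\varphi''>-1$. Then $$\mathbb{E}[\tau]\ge\frac{\varphi(\pi)-\varphi(0)}{1+\max_{[0,\pi]}\varphi''}.$$
   Context: $(B(t))_{t\ge 0}$ is a standard real Brownian motion. The diffusion is defined up to the time $\tau$. ''Entrance boundary'' means that the diffusion can be started at $0$ and never returns to $0$ at positive times. *)

(* Defs.v *)
From HB Require Import structures.
From mathcomp Require Import all_boot all_order all_algebra.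
From mathcomp Require Import all_classical all_reals all_analysis.

Set Implicit Arguments.
Unset Strict Implicit.
Unset Printing Implicit Defensive.

Import Order.TTheory GRing.Theory Num.Theory.
Import numFieldNormedType.Exports.

Local Open Scope classical_set_scope.
Local Open Scope ring_scope.

Definition diff_quotient (R : realType) (f : R -> R) (x y : R) : R :=
  (f y - f x) / (y - x).

(* Derivatives relative to A: for A a closed interval, one-sided at the
   endpoints, so that nothing is assumed about f outside A. *)
Definition derivable_on (R : realType) (A : set R) (f : R -> R) : Prop :=
  forall x, A x -> cvg (diff_quotient f x y @[y --> within A x^']).

Definition deriv_on (R : realType) (A : set R) (f : R -> R) (x : R) : R :=
  lim (diff_quotient f x y @[y --> within A x^']).

Definition C2_on (R : realType) (A : set R) (f : R -> R) : Prop :=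
  [/\ derivable_on A f, derivable_on A (deriv_on A f) &
      {within A, continuous (deriv_on A (deriv_on A f))}].

Definition is_max_on (R : realType) (A : set R) (f : R -> R) (M : R) : Prop :=
  (exists2 x, A x & f x = M) /\ (forall x, A x -> f x <= M).

(* In what follows processes are indexed by the reals, and only their values at
   nonnegative times are constrained. *)

Definition is_filtration (R : realType) (d : measure_display)
    (T : measurableType d) (F : R -> set (set T)) : Prop :=
  [/\ forall t, 0 <= t -> sigma_algebra setT (F t),
      forall t, 0 <= t -> F t `<=` measurable &
      forall s t, 0 <= s -> s <= t -> F s `<=` F t].

Definition adapted (R : realType) (d : measure_display) (T : measurableType d)
    (F : R -> set (set T)) (X : R -> T -> R) : Prop :=
  forall t, 0 <= t -> forall U : set R, measurable U -> F t (X t @^-1` U).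

Definition continuous_paths (R : realType) (d : measure_display)
    (T : measurableType d) (P : probability T R) (X : R -> T -> R) : Prop :=
  {ae P, forall w, {within `[0, +oo[, continuous (fun t => X t w)}}.

(* Standard real Brownian motion relative to the filtration F.  The last clause
   says at once that B t - B s is independent of F s and that it is centred
   Gaussian with variance t - s (take A := setT); the second parameter of
   normal_prob is the standard deviation. *)
Definition brownian_motion (R : realType) (d : measure_display)
    (T : measurableType d) (P : probability T R) (F : R -> set (set T))
    (B : R -> T -> R) : Prop :=
  [/\ is_filtration F,
      adapted F B,
      {ae P, forall w, B 0 w = 0},
      continuous_paths P B &
      forall s t, 0 <= s -> s < t ->
      forall (A : set T) (U : set R), F s A -> measurable U ->
        P (A `&` (fun w => B t w - B s w) @^-1` U) =
        (P A * normal_prob 0 (Num.sqrt (t - s)) U)%E].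

Definition hitting_time (R : realType) (T : Type) (X : R -> T -> R) (a : R)
    (w : T) : \bar R :=
  ereal_inf [set t%:E | t in [set t : R | 0 <= t /\ X t w = a]].

(* X is a (weak) solution, with state space [0, pi], started at 0 and run up to
   its hitting time of pi, of
     dX(t) = sqrt 2 dB(t) + 1 / phi'(X(t)) dt.
   The noise being additive, the equation is a pathwise integral equation.  It
   is written in \bar R, which forces the integral of the nonnegative drift to
   be finite; the convention 0^-1 = 0 where phi' vanishes (at 0 or pi) is
   harmless, since X spends a Lebesgue-null time there.  After the
   hitting time of pi, X is an arbitrary continuous adapted continuation (for
   instance constant). *)
Definition diffusion_from0 (R : realType) (phi : R -> R) (d : measure_display)
    (T : measurableType d) (P : probability T R) (F : R -> set (set T))
    (B X : R -> T -> R) : Prop :=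
  [/\ brownian_motion P F B,
      adapted F X,
      continuous_paths P X,
      {ae P, forall w, X 0 w = 0} &
      {ae P, forall w, forall t, 0 <= t -> (t%:E <= hitting_time X pi w)%E ->
        X t w \in `[0, pi] /\
        (X t w)%:E = ((X 0 w + Num.sqrt 2 * B t w)%:E +
          \int[lebesgue_measure]_(s in `[0%R, t])
             ((deriv_on `[0, pi] phi (X s w))^-1)%:E)%E}].

(* 0 is an entrance boundary: the diffusion can be started at 0, and it never
   returns to 0 at positive times (within its lifetime). *)
Definition entrance_boundary0 (R : realType) (phi : R -> R) : Prop :=
  (exists (d : measure_display) (T : measurableType d) (P : probability T R)
     (F : R -> set (set T)) (B X : R -> T -> R),
     diffusion_from0 phi P F B X) /\
  (forall (d : measure_display) (T : measurableType d) (P : probability T R)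
     (F : R -> set (set T)) (B X : R -> T -> R),
     diffusion_from0 phi P F B X ->
     {ae P, forall w, forall t, 0 < t -> (t%:E <= hitting_time X pi w)%E ->
       X t w != 0}).

(* Main.v *)
Require Import Defs.
From HB Require Import structures.
From mathcomp Require Import all_boot all_order all_algebra.
From mathcomp Require Import all_classical all_reals all_analysis.
From mathcomp Require Import measurable_realfun ring lra.

Set Implicit Arguments.
Unset Strict Implicit.
Unset Printing Implicit Defensive.

Import Order.TTheory GRing.Theory Num.Theory.
Import numFieldNormedType.Exports.

Local Open Scope classical_set_scope.
Local Open Scope ring_scope.

(** Write [psi] for the derivative of [phi], [W] for [X - sqrt 2 B], and [dB],
    [dW], [dX] for increments over a step of length [h].  The noise being
    additive, [W] is nondecreasing up to the hitting time [tau] of [pi], with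
    derivative [1 / psi (X)], and no stochastic integral is needed.

    Since the second derivative of [phi] is at most [M], over one step
    [phi] grows by at most [psi (X) dX + M / 2 dX ^ 2], with
    [dX = sqrt 2 dB + dW] ([second_order_bound]).  As [psi] is Lipschitz and
    [dW] integrates [1 / psi (X)], the product [psi (X) dW] is at most [h] up to
    a small multiple of [dW] ([drift_increment]).  Hence the gain of [phi] is at
    most [sqrt 2 psi (X) dB + M dB ^ 2 + h] plus [O(e) dW], where [e] bounds the
    oscillations of [X] and [B] over a step ([controlled_step]).

    These inequalities are added over the steps begun while the path is
    controlled: at distance at least [e] from [pi], with [W] at most [K] and
    oscillations at most [e].  This event is known at the beginning of the step,
    so that [dB] is independent of it and the expectation of the sum is
    [(1 + M) h] times the sum of the probabilities of control
    ([has_mean_step]).  As control implies that [tau] is not reached, this is at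
    most [(1 + M) (E tau + h)] ([sum_ctl_le_mean_hitting]).  The errors [O(e) dW]
    add up to [O(e) K].  On the step where control is lost the sum is bounded
    below using a fourth power of [dB], of mean [O(h ^ 2)], hence negligible
    ([quartic_young]).

    Apart from events whose probability vanishes as [K] grows and [h] decreases,
    control is lost because [X] comes close to [pi], and then [phi] has gained
    about [phi pi - phi 0] ([good_path_sum]); the probability that control lasts
    until time [n] is at most [E tau / n] ([survival_le_mean_hitting]).  Letting
    [n] and [K] grow, then [e] and [h] decrease, gives the inequality.

    The moments of Gaussian increments are derived from the mean of
    [exp (t V)] and [exp (u V ^ 2)], which only require the normalization of the
    Gaussian density.  The measurability of [tau] is never used: lower bounds on
    the integral of [tau] come from measurable functions below it
    ([ge0_integral_ge]). *)

(** * Exponential moments of Gaussian laws *)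

Section normal_moments.
Variable R : realType.
Implicit Types s t u x : R.
Local Notation mu := (@lebesgue_measure R).

(** The Gaussian law has the Gaussian density: integrals against it are
    integrals against Lebesgue measure. *)
Lemma ge0_integral_normal_prob s (f : R -> \bar R) :
  measurable_fun setT f -> (forall x, 0 <= f x)%E ->
  (\int[normal_prob 0 s]_x f x =
   \int[mu]_x (f x * (normal_pdf 0 s x)%:E))%E.
Proof.
move=> mf f0.
have dom := @normal_prob_dominates R 0 s.
rewrite -(Radon_Nikodym_SigmaFinite.change_of_variables dom)//.
have ifd := Radon_Nikodym_SigmaFinite.f_integrable dom.
have mpdf : measurable_fun setT (EFin \o normal_pdf 0 s : R -> \bar R).
  by apply/measurable_EFinP; exact: measurable_normal_pdf.
apply: ae_eq_integral => //.
- apply: emeasurable_funM => //; exact: measurable_int ifd.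
- exact: emeasurable_funM.
- apply: ae_eqe_mul2l; apply: integral_ae_eq => // E _ mE.
  by rewrite -Radon_Nikodym_SigmaFinite.f_integral.
Qed.

Let integral_scaled_normal_pdf (m s c : R) : 0 <= c ->
  (\int[mu]_x (c%:E * (normal_pdf m s x)%:E) = c%:E)%E.
Proof.
move=> c0; have := @ge0_integralZl_EFin _ _ _ mu setT measurableT
  (EFin \o normal_pdf m s) _ _ _ c0.
rewrite [X in _ = (_ * X)%E]integral_normal_pdf mule1; apply.
- by move=> x _; rewrite lee_fin normal_pdf_ge0.
- by apply/measurable_EFinP; exact: measurable_normal_pdf.
Qed.

Lemma normal_mgf s t : s != 0 ->
  (\int[normal_prob 0 s]_x (expR (t * x))%:E = (expR (t ^+ 2 * s ^+ 2 / 2))%:E)%E.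
Proof.
move=> s0; rewrite ge0_integral_normal_prob; last 2 first.
- apply/measurable_EFinP; exact: measurableT_comp.
- by move=> x; rewrite lee_fin expR_ge0.
transitivity (\int[mu]_x ((expR (t ^+ 2 * s ^+ 2 / 2))%:E *
    (normal_pdf (t * s ^+ 2) s x)%:E))%E.
  apply: eq_integral => x _; rewrite -!EFinM !normal_pdfE//; congr EFin.
  rewrite /normal_fun [LHS]mulrCA [RHS]mulrCA; congr (_ * _).
  rewrite -!expRD; congr expR; field.
  by rewrite s0.
by rewrite integral_scaled_normal_pdf// expR_ge0.
Qed.

(** Completing the exponent turns the centred density of deviation [s] into a
    multiple of the one of deviation [s / Num.sqrt (1 - 2 * u)]. *)
Lemma normal_sqr_mgf s u : 0 < s -> u < 1 / 2 ->
  (\int[normal_prob 0 s]_x (expR (u * x ^+ 2 / s ^+ 2))%:E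
    = ((Num.sqrt (1 - 2 * u))^-1)%:E)%E.
Proof.
move=> s0 u2; rewrite ge0_integral_normal_prob; last 2 first.
- apply/measurable_EFinP; apply: measurableT_comp => //.
  by apply: measurable_funM => //; apply: measurable_funM => //.
- by move=> x; rewrite lee_fin expR_ge0.
have v0 : 0 < 1 - 2 * u by lra.
set r := Num.sqrt (1 - 2 * u).
have r0 : 0 < r by rewrite sqrtr_gt0.
have r2 : r ^+ 2 = 1 - 2 * u by rewrite sqr_sqrtr// ltW.
have sr0 : s / r != 0 by rewrite mulf_neq0 ?invr_eq0// gt_eqF.
transitivity (\int[mu]_x ((r^-1)%:E * (normal_pdf 0 (s / r) x)%:E))%E.
  apply: eq_integral => x _; rewrite -!EFinM !normal_pdfE// ?gt_eqF//; congr EFin.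
  rewrite /normal_fun [LHS]mulrCA [RHS]mulrA; congr (_ * _).
    rewrite /normal_peak (_ : (s / r) ^+ 2 * pi *+ 2 =
      (s ^+ 2 * pi *+ 2) * r^-1 ^+ 2); last by field; rewrite gt_eqF.
    rewrite [in RHS]sqrtrM ?mulrn_wge0 ?mulr_ge0 ?pi_ge0 ?(ltW s0)//.
    rewrite sqrtr_sqr ger0_norm ?invr_ge0 ?(ltW r0)//.
    by rewrite invfM invrK mulrCA mulVf ?mulr1// gt_eqF.
  rewrite -!expRD; congr expR; rewrite !subr0.
  have -> : u = (1 - r ^+ 2) / 2 by rewrite r2; lra.
  field; by rewrite !gt_eqF.
by rewrite integral_scaled_normal_pdf// invr_ge0 ltW.
Qed.

End normal_moments.

(** * Means and independence *)

Section product_law.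
Context d (T : measurableType d) (R : realType) (P : probability T R).
Variables (Y V : {mfun T >-> R}) (nu : probability R R).
Hypothesis indep : forall S U : set R, measurable S -> measurable U ->
  P (Y @^-1` S `&` V @^-1` U) = (P (Y @^-1` S) * nu U)%E.

Let Z w := (Y w, V w).
Let mZ : measurable_fun setT Z. Proof. exact: measurable_fun_pair. Qed.
Let Zmixin := isMeasurableFun.Build _ _ _ _ _ mZ.
Let Zm : {mfun T >-> (R * R)%type} := HB.pack Z Zmixin.

(** If the joint law of [Y] and [V] is the product of the law of [Y] by [nu],
    means of products of nonnegative functions of [Y] and [V] factor. *)
Lemma ge0_integral_prod_indep (f g : R -> \bar R) :
  measurable_fun setT f -> (forall x, 0 <= f x)%E ->
  measurable_fun setT g -> (forall x, 0 <= g x)%E ->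
  (\int[P]_w (f (Y w) * g (V w)) = \int[P]_w f (Y w) * \int[nu]_y g y)%E.
Proof.
move=> mf f0 mg g0.
pose k (z : R * R) := (f z.1 * g z.2)%E.
have mk : measurable_fun setT k.
  by apply: emeasurable_funM; exact: measurableT_comp.
have k0 z : (0 <= k z)%E by rewrite mule_ge0.
transitivity (\int[distribution P Zm]_z k z)%E.
  by rewrite ge0_integral_distribution.
transitivity (\int[(distribution P Y \x nu)]_z k z)%E.
  apply: eq_measure_integral => A mA _; apply/esym.
  exact: (@product_measure_unique _ _ _ _ _ _ _ (distribution P Zm)).
rewrite fubini_tonelli1//.
transitivity (\int[distribution P Y]_x (f x * \int[nu]_y g y))%E.
  apply: eq_integral => x _.
  exact: (ge0_integralZl nu measurableT mg (fun y _ => g0 y) (f0 x)).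
have nug0 : (0 <= \int[nu]_y g y)%E by exact: integral_ge0.
rewrite (ge0_integralZr _ measurableT mf (fun y _ => f0 y) nug0).
by rewrite ge0_integral_distribution.
Qed.

End product_law.

Section mean.
Context d (T : measurableType d) (R : realType) (P : probability T R).
Implicit Types (f g : T -> R) (a b c : R).

(** [f] is integrable with expectation [a]. *)
Definition has_mean f a := P.-integrable setT (EFin \o f) /\
  (\int[P]_w (f w)%:E = a%:E)%E.

Lemma has_mean_measurable f a : has_mean f a -> measurable_fun setT f.
Proof. by move=> [fi _]; apply/measurable_EFinP; exact: measurable_int fi. Qed.

Lemma has_mean_eq f g a b : has_mean f a -> f =1 g -> a = b -> has_mean g b.
Proof. by move=> fa /funext <- <-. Qed.

Lemma has_mean_add f g a b : has_mean f a -> has_mean g b ->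
  has_mean (fun w => f w + g w) (a + b).
Proof.
move=> [fi fa] [gi gb]; split.
  exact: eq_integrable (integrableD measurableT fi gi).
by rewrite EFinD -fa -gb -integralD.
Qed.

Lemma has_mean_scale c f a : has_mean f a -> has_mean (fun w => c * f w) (c * a).
Proof.
move=> [fi fa]; split.
  exact: eq_integrable (integrableZl measurableT c fi).
by rewrite EFinM -fa -integralZl.
Qed.

Lemma has_mean_cst c : has_mean (fun=> c) c.
Proof.
split; first exact: finite_measure_integrable_cst.
by rewrite integral_cst//= probability_setT mule1.
Qed.

Lemma has_mean_indic (A : set T) : measurable A ->
  has_mean \1_A (fine (P A)).
Proof.
move=> mA; split; first exact: integrable_indic.
by rewrite integral_indic// setIT fineK// fin_num_measure.
Qed.

Lemma has_mean_sum n (f : nat -> T -> R) (a : nat -> R) :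
  (forall i, (i < n)%N -> has_mean (f i) (a i)) ->
  has_mean (fun w => \sum_(0 <= i < n) f i w) (\sum_(0 <= i < n) a i).
Proof.
elim: n => [|n IH] fa.
  by rewrite big_geq// (_ : (fun _ => _) = cst 0) ?funeqE => [|w];
    [exact: has_mean_cst|rewrite big_geq].
rewrite big_nat_recr//= (_ : (fun _ => _) =
    fun w => \sum_(0 <= i < n) f i w + f n w); last first.
  by apply/funext => w; rewrite big_nat_recr.
apply: has_mean_add; last exact: fa.
by apply: IH => i /ltnW; exact: fa.
Qed.

Lemma has_mean_ae_le f g a b : has_mean f a -> has_mean g b ->
  {ae P, forall w, f w <= g w} -> a <= b.
Proof.
move=> fa gb fg; have mf := has_mean_measurable fa.
have mg := has_mean_measurable gb.
have [hi hc] := has_mean_add gb (has_mean_scale (- 1) fa).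
rewrite -subr_ge0 -[b - a]/(b - a) -mulN1r -lee_fin -hc.
rewrite (@ae_eq_integral _ _ _ P setT
  (fun w => (Num.max 0 (g w + -1 * f w))%:E))//.
- by apply: integral_ge0 => w _; rewrite lee_fin le_max lexx.
- exact: measurable_int hi.
- apply/measurable_EFinP; apply: measurable_maxr => //.
  by apply: measurable_funD => //; exact: measurable_funM.
- apply: filterS fg => w fgw _; congr EFin.
  by rewrite mulN1r max_r// subr_ge0.
Qed.

(** A nonnegative measurable function with a finite integral is integrable. *)
Lemma has_mean_ge0 f a : measurable_fun setT f -> (forall w, 0 <= f w) ->
  (\int[P]_w (f w)%:E = a%:E)%E -> has_mean f a.
Proof.
move=> mf f0 fa; split => //; apply/integrableP; split.
  exact/measurable_EFinP.
under eq_integral do rewrite /= ger0_norm//.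
by rewrite fa ltry.
Qed.

End mean.

(** * Weighted moments of an independent Gaussian variable *)

Section bounds.
Variable R : realType.
Implicit Types (t u v k m x : R).

(** A linear function of [t] that stays below [t * v] up to [O(t ^+ 2)] near
    [0], for both signs of [t], has slope [v]. *)
Lemma eq_of_sqr_tangent m v k :
  (forall t, `|t| <= 1 / 4 -> t * m <= t * v + k * t ^+ 2) -> m = v.
Proof.
move=> H; apply/eqP; rewrite -subr_eq0 -normr_le0; apply/ler_addgt0Pl => e e0.
have k0 : 0 < `|k| + 1 by rewrite ltr_wpDl.
pose t := Num.min (1 / 4) (e / (`|k| + 1)).
have t0 : 0 < t by rewrite lt_min divr_gt0//= divr_gt0.
have t4 : t <= 1 / 4 by rewrite ge_min lexx.
have tk : t * `|k| <= e.
  rewrite (@le_trans _ _ (t * (`|k| + 1)))//; first by rewrite ler_wpM2l ?lerDl// ltW.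
  by rewrite -ler_pdivlMr// ge_min lexx orbT.
have kk : k * t ^+ 2 <= `|k| * t ^+ 2 by rewrite ler_wpM2r ?sqr_ge0 ?ler_norm.
have H1 : t * (m - v) <= t * e.
  have := H t; rewrite (ger0_norm (ltW t0)) => /(_ t4) => h.
  by apply: (@le_trans _ _ (t * (t * `|k|))); [nra|rewrite ler_wpM2l// ltW].
have H2 : t * (v - m) <= t * e.
  have := H (- t); rewrite normrN (ger0_norm (ltW t0)) => /(_ t4) => h.
  by apply: (@le_trans _ _ (t * (t * `|k|))); [nra|rewrite ler_wpM2l// ltW].
rewrite addr0 ler_norml; rewrite !ler_pM2l// in H1 H2.
by apply/andP; split; lra.
Qed.

Lemma expR_sqr_le k t : 0 <= k -> `|t| <= 1 / 4 ->
  expR (t ^+ 2 * k / 2) <= 1 + t * 0 + (k * expR k) * t ^+ 2.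
Proof.
move=> k0 t4; have t2 : t ^+ 2 <= 1.
  rewrite -real_normK ?num_real// expr_le1//; lra.
have t20 := sqr_ge0 t.
set x := t ^+ 2 * k / 2.
have x0 : 0 <= x by rewrite /x divr_ge0// mulr_ge0.
have xk : x <= k by rewrite /x; nra.
have := expR_ge1Dx (- x); rewrite expRN => h.
have ex0 := expR_gt0 x.
have h2 : expR x * (1 - x) <= 1 by rewrite mulrC -ler_pdivlMr// mul1r.
have h3 : expR x <= expR k by rewrite ler_expR.
have : x * expR x <= (k * expR k) * t ^+ 2.
  apply: (@le_trans _ _ (x * expR k)); first by rewrite ler_wpM2l.
  rewrite /x; have := mulr_ge0 (mulr_ge0 t20 k0) (expR_ge0 k); lra.
nra.
Qed.

Lemma invsqrt_le t : `|t| <= 1 / 4 ->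
  (Num.sqrt (1 - 2 * t))^-1 <= 1 + t * 1 + 4 * t ^+ 2.
Proof.
rewrite ler_norml => /andP[t1 t2].
have p0 : 0 < 1 + t * 1 + 4 * t ^+ 2 by have := sqr_ge0 t; lra.
have v0 : 0 < 1 - 2 * t by lra.
rewrite -[leRHS]invrK lef_pV2 ?posrE ?invr_gt0// ?sqrtr_gt0//.
rewrite -(ler_pXn2r (n := 2))// ?nnegrE ?invr_ge0 ?(ltW p0) ?sqrtr_ge0//.
rewrite (sqr_sqrtr (ltW v0)) exprVn -div1r ler_pdivrMr ?exprn_gt0//.
have -> : (1 - 2 * t) * (1 + t * 1 + 4 * t ^+ 2) ^+ 2 =
  1 + t ^+ 2 * (5 - 10 * t - 32 * t ^+ 3) by ring.
rewrite lerDl mulr_ge0 ?sqr_ge0//.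
have t22 : t ^+ 2 <= 1 / 16 by nra.
have := sqr_ge0 t; rewrite exprS; nra.
Qed.

Lemma sqr_le_expR x : 0 <= x -> x ^+ 2 <= 4 * expR x.
Proof.
move=> x0; have := expR_ge1Dx (x / 2) => h.
have -> : expR x = expR (x / 2) ^+ 2 by rewrite -expRM_natl -mulr_natr; congr expR; field.
have : (1 + x / 2) ^+ 2 <= expR (x / 2) ^+ 2.
  by rewrite ler_pXn2r// ?nnegrE ?expR_ge0// addr_ge0// divr_ge0.
nra.
Qed.

End bounds.

Section tangent_mean.
Context d (T : measurableType d) (R : realType) (P : probability T R).

(** How a weighted mean of [Z] is read off from exponential moments: if
    [1 + t * Z] is dominated by [W t], whose weighted mean is [c * F t] with
    [F] tangent to [1 + t * v] at [t = 0], then [Z] has weighted mean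
    [c * v].  Domination for both signs of [t] also gives integrability. *)
Lemma has_mean_tangent (Y Z : T -> R) (W : R -> T -> R) (F : R -> R) (c v k : R) :
  (forall w, 0 <= Y w) -> measurable_fun setT Z -> 0 <= c ->
  (forall t w, `|t| <= 1 / 4 -> 1 + t * Z w <= W t w) ->
  (forall t w, 0 <= W t w) ->
  (forall t, `|t| <= 1 / 4 -> F t <= 1 + t * v + k * t ^+ 2) ->
  has_mean P Y c ->
  (forall t, `|t| <= 1 / 4 -> has_mean P (fun w => Y w * W t w) (c * F t)) ->
  has_mean P (fun w => Y w * Z w) (c * v).
Proof.
move=> Y0 mZ c0 ZW W0 FW Yc WF; have mY := has_mean_measurable Yc.
have q4 : `|1 / 4 : R| <= 1 / 4 by rewrite ger0_norm.
have q4N : `|- (1 / 4) : R| <= 1 / 4 by rewrite normrN.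
have mYZ : measurable_fun setT (fun w => Y w * Z w) by exact: measurable_funM.
have iYZ : P.-integrable setT (fun w => (Y w * Z w)%:E).
  have [iW _] := has_mean_scale 4 (has_mean_add (WF _ q4) (WF _ q4N)).
  apply: le_integrable iW => //; first exact/measurable_EFinP.
  move=> w _; rewrite lee_fin normrM (ger0_norm (Y0 w)).
  have h1 := ZW _ w q4; have h2 := ZW _ w q4N; have w1 := W0 (1 / 4) w; have w2 := W0 (- (1 / 4)) w.
  have zw : `|Z w| <= 4 * (W (1 / 4) w + W (- (1 / 4)) w).
    by rewrite ler_norml; apply/andP; split; lra.
  apply: le_trans (ler_norm _); rewrite -mulrDr mulrCA; exact: ler_wpM2l.
have [m mE] : exists m, has_mean P (fun w => Y w * Z w) m.
  exists (fine (\int[P]_w (Y w * Z w)%:E)); split => //.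
  by rewrite fineK//; exact: integrable_fin_num.
suff -> : c * v = m by [].
apply/esym/(@eq_of_sqr_tangent _ _ _ (c * k)) => t t4.
have := has_mean_ae_le (has_mean_add Yc (has_mean_scale t mE)) (WF t t4).
have h : c * F t <= c * (1 + t * v + k * t ^+ 2) by rewrite ler_wpM2l// FW.
move=> H; have {}H : c + t * m <= c * F t.
  apply: H; apply: aeW => w; have := ler_wpM2l (Y0 w) (ZW t w t4); lra.
lra.
Qed.

(* From here on [V] is centred Gaussian of variance [h] and independent of the
   nonnegative weight [Y]. *)
Variables (Y V : {mfun T >-> R}) (h : R).
Hypothesis h0 : 0 < h.
Hypothesis indep : forall S U : set R, measurable S -> measurable U ->
  P (Y @^-1` S `&` V @^-1` U) = (P (Y @^-1` S) * normal_prob 0 (Num.sqrt h) U)%E.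
Hypothesis Y0 : forall w, 0 <= Y w.
Variable c : R.
Hypothesis Yc : has_mean P Y c.

Let sh0 : 0 < Num.sqrt h. Proof. by rewrite sqrtr_gt0. Qed.
Let sh2 : Num.sqrt h ^+ 2 = h. Proof. by rewrite sqr_sqrtr// ltW. Qed.

Let c0 : 0 <= c.
Proof.
have [_ e] := Yc; rewrite -lee_fin -e; apply: integral_ge0 => w _.
by rewrite lee_fin.
Qed.

(* [normal_prob] lives on [measurableTypeR R]; its image under the identity is
   the same law on [R]. *)
Let idTR : measurableTypeR R -> R := idfun.
#[local] HB.instance Definition _ :=
  @isMeasurableFun.Build _ _ _ _ idTR (@measurable_id _ _ setT).

Let has_mean_prod (g : R -> R) b : measurable_fun setT g ->
  (forall x, 0 <= g x) ->
  (\int[normal_prob 0 (Num.sqrt h)]_x (g x)%:E = b%:E)%E ->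
  has_mean P (fun w => Y w * g (V w)) (c * b).
Proof.
move=> mg g0 gb; apply: has_mean_ge0.
- by apply: measurable_funM => //; exact: measurableT_comp.
- by move=> w; rewrite mulr_ge0.
- have mn : measurable_fun setT (fun y : R => (`|y|)%:E).
    by apply/measurable_EFinP; exact: normr_measurable.
  have mgE : measurable_fun setT (EFin \o g) by exact/measurable_EFinP.
  have := @ge0_integral_prod_indep _ _ _ P Y V
    (distribution (normal_prob 0 (Num.sqrt h)) idTR) indep _ _
    mn (fun y => normr_ge0 y) mgE g0.
  rewrite ge0_integral_distribution// [X in (_ * X)%E]gb.
  rewrite [X in _ = (X * _)%E](_ : _ = \int[P]_w (Y w)%:E)%E; last first.
    by apply: eq_integral => w _; rewrite (ger0_norm (Y0 w)).
  have [_ ->] := Yc; rewrite -EFinM => <-.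
  by apply: eq_integral => w _; rewrite (ger0_norm (Y0 w)).
Qed.

Lemma has_mean_normal_linear : has_mean P (fun w => Y w * V w) 0.
Proof.
rewrite -[X in has_mean _ _ X](mulr0 c).
apply: (@has_mean_tangent _ _ (fun t w => expR (t * V w))
  (fun t => expR (t ^+ 2 * h / 2)) c 0 (h * expR h)) => //.
- by move=> t w _; exact: expR_ge1Dx.
- by move=> t; apply: expR_sqr_le; exact: ltW.
- move=> t _; apply: (@has_mean_prod (fun x => expR (t * x))) => //.
    exact: measurableT_comp.
  have sn0 : Num.sqrt h != 0 by rewrite gt_eqF.
  by have := normal_mgf t sn0; rewrite sh2.
Qed.

Let normal_sqr_mgf_h t : t < 1 / 2 ->
  (\int[normal_prob 0 (Num.sqrt h)]_x (expR (t * (x ^+ 2 / h)))%:E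
    = ((Num.sqrt (1 - 2 * t))^-1)%:E)%E.
Proof.
move=> t2; have := normal_sqr_mgf sh0 t2; rewrite sh2 => <-.
by apply: eq_integral => x _; rewrite mulrA.
Qed.

Lemma has_mean_normal_sqr : has_mean P (fun w => Y w * V w ^+ 2) (c * h).
Proof.
have H : has_mean P (fun w => Y w * (V w ^+ 2 / h)) (c * 1).
  apply: (@has_mean_tangent _ _ (fun t w => expR (t * (V w ^+ 2 / h)))
    (fun t => (Num.sqrt (1 - 2 * t))^-1) c 1 4) => //.
  - by apply: measurable_funM => //; exact: measurable_funX.
  - by move=> t w _; exact: expR_ge1Dx.
  - by move=> t; exact: invsqrt_le.
  - move=> t t4; apply: (@has_mean_prod (fun x => expR (t * (x ^+ 2 / h)))) => //.
      by apply: measurableT_comp => //; apply: measurable_funM => //; apply: measurable_funM.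
    by apply: normal_sqr_mgf_h; move: t4; rewrite ler_norml => /andP[]; lra.
have := has_mean_scale h H; rewrite mulr1 mulrC.
rewrite (_ : (fun _ => _) = (fun w => Y w * V w ^+ 2))//.
by apply/funext => w; field; rewrite gt_eqF.
Qed.

Lemma has_mean_normal_pow4 : exists2 b,
  has_mean P (fun w => Y w * V w ^+ 4) b & b <= c * (128 * h ^+ 2).
Proof.
have H : has_mean P (fun w => Y w * expR (1 / 4 * (V w ^+ 2 / h)))
    (c * (Num.sqrt (1 - 2 * (1 / 4)))^-1).
  apply: (@has_mean_prod (fun x => expR (1 / 4 * (x ^+ 2 / h)))) => //.
    by apply: measurableT_comp => //; apply: measurable_funM => //; apply: measurable_funM.
  by apply: normal_sqr_mgf_h; lra.
have le4 w : Y w * V w ^+ 4 <=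
    64 * h ^+ 2 * (Y w * expR (1 / 4 * (V w ^+ 2 / h))).
  have : V w ^+ 4 <= 64 * h ^+ 2 * expR (1 / 4 * (V w ^+ 2 / h)).
    have := @sqr_le_expR _ (1 / 4 * (V w ^+ 2 / h)) _.
    rewrite mulr_ge0 ?divr_ge0 ?sqr_ge0 ?(ltW h0)// => /(_ erefl) e.
    rewrite (_ : V w ^+ 4 = 16 * h ^+ 2 * (1 / 4 * (V w ^+ 2 / h)) ^+ 2).
      by have := sqr_ge0 h; nra.
    by field; rewrite gt_eqF.
  by move=> e; rewrite [leRHS]mulrCA; exact: ler_wpM2l.
have mYV : measurable_fun setT (fun w => Y w * V w ^+ 4).
  by apply: measurable_funM => //; exact: measurable_funX.
have YV0 w : 0 <= Y w * V w ^+ 4 by rewrite mulr_ge0// exprn_even_ge0.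
have H2 := has_mean_scale (64 * h ^+ 2) H.
have iYV : P.-integrable setT (fun w => (Y w * V w ^+ 4)%:E).
  have [iW _] := H2; apply: le_integrable iW => //.
    exact/measurable_EFinP.
  by move=> w _; rewrite lee_fin (ger0_norm (YV0 w)); apply: le_trans (ler_norm _).
have bE : has_mean P (fun w => Y w * V w ^+ 4)
    (fine (\int[P]_w (Y w * V w ^+ 4)%:E)).
  by split => //; rewrite fineK//; exact: integrable_fin_num.
exists (fine (\int[P]_w (Y w * V w ^+ 4)%:E)) => //.
apply: le_trans (has_mean_ae_le bE H2 _) _; first exact: aeW.
have q4 : `|1 / 4 : R| <= 1 / 4 by rewrite ger0_norm.
have := invsqrt_le q4; set s := (Num.sqrt _)^-1 => hs.
have {}hs : s <= 2 by apply: le_trans hs _; lra.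
have := mulr_ge0 c0 (sqr_ge0 h); nra.
Qed.

End tangent_mean.

(** * Derivatives relative to a segment *)

Section derivative_on_segment.
Variables (R : realType) (a b : R).
Hypothesis ab : a < b.
Implicit Types (f g : R -> R) (x y c : R).
Local Notation A := (`[a, b]%classic).

Lemma derivable_on_cvg f x : derivable_on A f -> x \in `[a, b] ->
  diff_quotient f x y @[y --> within A x^'] --> deriv_on A f x.
Proof. by move=> df xA; exact: df. Qed.

(** First order expansion, at an endpoint as well as inside. *)
Lemma derivable_on_approx f x e : derivable_on A f -> x \in `[a, b] -> 0 < e ->
  exists2 d, 0 < d & forall y, y \in `[a, b] -> `|y - x| < d ->
    `|f y - f x - deriv_on A f x * (y - x)| <= e * `|y - x|.
Proof.
move=> df xA e0; have /cvgrPdist_lt/(_ e e0) := derivable_on_cvg df xA.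
move=> /nbhs_ballP[d /= d0 H]; exists d => // y yA yx.
have [->|neq] := eqVneq y x; first by rewrite !subrr mulr0 subr0 normr0 mulr0.
have yb : ball x d y by rewrite /ball /= distrC.
have := H y yb neq yA; rewrite /diff_quotient => h.
have yx0 : y - x != 0 by rewrite subr_eq0.
rewrite (_ : f y - f x - _ = - (deriv_on A f x - (f y - f x) / (y - x)) * (y - x)).
  by rewrite normrM normrN ler_wpM2r// ltW.
by field.
Qed.

Lemma derivable_on_continuous f : derivable_on A f ->
  {within A, continuous f}.
Proof.
move=> df; apply/subspace_continuousP => x xA.
apply/cvgrPdist_le => e e0.
have [d d0 H] := derivable_on_approx df xA ltr01.
set l := deriv_on A f x in H.
have k0 : 0 < 1 + `|l| by rewrite ltr_pwDl.
apply/nbhs_ballP; exists (Num.min d (e / (1 + `|l|))) => /=.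
  by rewrite lt_min d0 divr_gt0.
move=> y; rewrite /ball /= distrC lt_min => /andP[yd ye] yA.
rewrite distrC; have := H y yA yd; rewrite mul1r => h.
rewrite (_ : f y - f x = (f y - f x - l * (y - x)) + l * (y - x)); last by ring.
apply: le_trans (ler_normD _ _) _; rewrite normrM.
apply: (@le_trans _ _ ((1 + `|l|) * `|y - x|)); first by rewrite mulrDl mul1r lerD2r.
by rewrite mulrC -ler_pdivlMr// ltW.
Qed.

Lemma derivable_on_is_derive f x : derivable_on A f -> x \in `]a, b[ ->
  is_derive x 1 f (deriv_on A f x).
Proof.
move=> df xab; have xA : x \in `[a, b] := subset_itv_oo_cc xab.
have cv : h^-1 *: (f (h *: (1 : R) + x) - f x) @[h --> 0^'] --> deriv_on A f x.
  apply/cvgrPdist_le => e e0.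
  have [d d0 H] := derivable_on_approx df xA e0.
  have /nbhs_ballP[d2 /= d20 H2] : \forall y \near x, y \in `]a, b[.
    by apply: near_in_itvoo.
  apply/nbhs_ballP; exists (Num.min d d2) => /=; first by rewrite lt_min d0.
  move=> h; rewrite /ball /= sub0r normrN lt_min => /andP[hd hd2] h0.
  have hx : h *: 1 + x - x = h by rewrite addrK [_ *: _]mulr1.
  have yA : h *: 1 + x \in `[a, b].
    by apply/subset_itv_oo_cc/H2; rewrite /ball /= distrC hx.
  have := H _ yA; rewrite hx => /(_ hd) {}H.
  rewrite distrC -(ler_pM2r (_ : 0 < `|h|)) ?normr_gt0// -normrM.
  apply: le_trans H; rewrite le_eqVlt; apply/orP; left; apply/eqP; congr `|_|.
  rewrite /GRing.scale /=; field.
  exact: h0.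
by apply: DeriveDef; [apply/cvg_ex; exists (deriv_on A f x)|exact: cvg_lim].
Qed.

Lemma subsegment_MVT (f df : R -> R) x y :
  (forall z, z \in `]a, b[ -> is_derive z 1 f (df z)) ->
  {within A, continuous f} ->
  x \in `[a, b] -> y \in `[a, b] -> x < y ->
  exists2 c, c \in `]x, y[ & f y - f x = df c * (y - x).
Proof.
move=> dfE cf xA yA xy.
have sub : {subset `[x, y] <= `[a, b]}.
  move=> z; move: xA yA; rewrite !in_itv /= => /andP[ax _] /andP[_ yb].
  by move=> /andP[xz zy]; rewrite (le_trans ax xz) (le_trans zy yb).
have d1 z : z \in `]x, y[ -> is_derive z 1 f (df z).
  move=> zxy; apply: dfE.
  move: xA yA zxy; rewrite !in_itv /= => /andP[ax _] /andP[_ yb].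
  by move=> /andP[xz zy]; rewrite (le_lt_trans ax xz) (lt_le_trans zy yb).
have c1 : {within `[x, y], continuous f}.
  by apply: continuous_subspaceW cf => z /=; exact: sub.
exact: MVT xy d1 c1.
Qed.

Lemma derivable_on_MVT f x y : derivable_on A f ->
  x \in `[a, b] -> y \in `[a, b] -> x < y ->
  exists2 c, c \in `]x, y[ & f y - f x = deriv_on A f c * (y - x).
Proof.
move=> df; apply: subsegment_MVT; last exact: derivable_on_continuous.
by move=> z zab; exact: derivable_on_is_derive.
Qed.

Lemma deriv_on_lipschitz f : derivable_on A f ->
  {within A, continuous (deriv_on A f)} ->
  exists2 L, 0 <= L & forall x y, x \in `[a, b] -> y \in `[a, b] ->
    `|f y - f x| <= L * `|y - x|.
Proof.
move=> df cdf.
have cn : {within A, continuous (fun x => `|deriv_on A f x|)}.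
  by move=> x; apply: cvg_norm; exact: cdf.
have [c cA cmax] := EVT_max (ltW ab) cn.
exists `|deriv_on A f c| => //.
have H x y : x \in `[a, b] -> y \in `[a, b] -> x < y ->
    `|f y - f x| <= `|deriv_on A f c| * `|y - x|.
  move=> xA yA xy; have [z zxy ->] := derivable_on_MVT df xA yA xy.
  rewrite normrM ler_wpM2r// cmax//.
  move: xA yA zxy; rewrite !in_itv /= => /andP[ax _] /andP[_ yb].
  by move=> /andP[/ltW xz /ltW zy]; rewrite (le_trans ax xz) (le_trans zy yb).
move=> x y xA yA; have [xy|yx|->] := ltgtP x y.
- exact: H.
- by rewrite distrC (distrC y); exact: H.
- by rewrite !subrr normr0 mulr0.
Qed.

(** Positivity inside the segment passes to the endpoints. *)
Lemma ge0_of_lipschitz f L : (forall x, x \in `]a, b[ -> 0 < f x) ->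
  (forall x y, x \in `[a, b] -> y \in `[a, b] ->
    `|f y - f x| <= L * `|y - x|) ->
  forall x, x \in `[a, b] -> 0 <= f x.
Proof.
move=> f0 fL x xA; rewrite leNgt; apply/negP => fx0.
set m := (a + b) / 2; have k0 : 0 < `|L| * `|m - x| + 1.
  by rewrite ltr_wpDl// mulr_ge0.
pose s := Num.min 1 (- f x / (`|L| * `|m - x| + 1)).
have s0 : 0 < s by rewrite lt_min ltr01 divr_gt0// oppr_gt0.
have s1 : s <= 1 by rewrite ge_min lexx.
have sk : s * (`|L| * `|m - x| + 1) <= - f x.
  by rewrite -ler_pdivlMr// ge_min lexx orbT.
have := xA; rewrite in_itv /= => /andP[ax xb].
have [ma mb] := midf_lt ab; rewrite -/m in ma mb.
pose y := x + s * (m - x).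
have yab : y \in `]a, b[.
  rewrite in_itv /= /y; apply/andP; split.
    have := mulr_gt0 s0 (_ : 0 < m - a); rewrite subr_gt0 => /(_ ma).
    have : 0 <= (1 - s) * (x - a) by rewrite mulr_ge0 ?subr_ge0.
    lra.
  have := mulr_gt0 s0 (_ : 0 < b - m); rewrite subr_gt0 => /(_ mb).
  have : 0 <= (1 - s) * (b - x) by rewrite mulr_ge0 ?subr_ge0.
  lra.
have := fL x y xA (subset_itv_oo_cc yab).
have -> : y - x = s * (m - x) by rewrite /y; ring.
rewrite normrM (gtr0_norm s0) => h.
have fy := f0 y yab; have h2 := le_trans (ler_norm _) h.
have : L * (s * `|m - x|) <= `|L| * (s * `|m - x|).
  by rewrite ler_wpM2r ?ler_norm// mulr_ge0// ltW.
lra.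
Qed.

(** Taylor's inequality of order two, in both directions from [x]; the
    remainder is bounded above by the supremum [M] of the second derivative,
    which may be negative. *)
Lemma second_order_bound f M : derivable_on A f ->
  derivable_on A (deriv_on A f) ->
  (forall x, x \in `[a, b] -> deriv_on A (deriv_on A f) x <= M) ->
  forall x y, x \in `[a, b] -> y \in `[a, b] ->
    f y - f x <= deriv_on A f x * (y - x) + M / 2 * (y - x) ^+ 2.
Proof.
move=> df ddf ddM x y xA yA; set g := deriv_on A f in ddf ddM *.
have gM u v : u \in `[a, b] -> v \in `[a, b] -> u <= v -> g v - g u <= M * (v - u).
  move=> uA vA; rewrite le_eqVlt => /predU1P[->|uv].
    by rewrite !subrr mulr0.
  have [z zuv ->] := derivable_on_MVT ddf uA vA uv.
  rewrite ler_wpM2r// ?subr_ge0 ?(ltW uv)// ddM//.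
  move: uA vA zuv; rewrite !in_itv /= => /andP[ax _] /andP[_ yb].
  by move=> /andP[/ltW xz /ltW zy]; rewrite (le_trans ax xz) (le_trans zy yb).
pose k z := f z - (g x * (z - x) + M / 2 * (z - x) ^+ 2).
pose dk z := g z - (g x + M * (z - x)).
have dkE z : z \in `]a, b[ -> is_derive z 1 k (dk z).
  move=> zab; have ? := derivable_on_is_derive df zab.
  rewrite /k /dk; apply: is_derive_eq.
  by rewrite /GRing.scale /= -/g; lra.
have ck : {within A, continuous k}.
  suff cp : {within A, continuous
      (fun z => g x * (z - x) + M / 2 * (z - x) ^+ 2)}.
    by move=> z; apply: cvgB; [exact: derivable_on_continuous|exact: cp].
  apply: continuous_subspaceT => z.
  by apply/differentiable_continuous/derivable1_diffP; exact: ex_derive.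
have kMVT u v := @subsegment_MVT k dk u v dkE ck.
suff : k y <= k x.
  by rewrite /k subrr expr0n /= !mulr0 !addr0 subr0; lra.
have [xy|yx|->//] := ltgtP x y.
- have [z zxy e] := kMVT _ _ xA yA xy; rewrite -subr_le0 e.
  move: (zxy); rewrite in_itv /= => /andP[xz zy].
  have zA : z \in `[a, b].
    by move: xA yA; rewrite !in_itv /= => /andP[ax _] /andP[_ yb]; apply/andP; split; lra.
  have := gM _ _ xA zA (ltW xz) => h.
  rewrite mulr_le0_ge0 ?subr_ge0 ?(ltW xy)// /dk; lra.
- have [z zxy e] := kMVT _ _ yA xA yx; rewrite -subr_ge0 e.
  move: (zxy); rewrite in_itv /= => /andP[yz zx].
  have zA : z \in `[a, b].
    by move: xA yA; rewrite !in_itv /= => /andP[_ ax] /andP[yb _]; apply/andP; split; lra.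
  have := gM _ _ zA xA (ltW zx) => h.
  rewrite mulr_ge0 ?subr_ge0 ?(ltW yx)// /dk; lra.
Qed.

End derivative_on_segment.

(** * Deterministic estimates along a path *)

Section discrete_path.
Variable R : realType.
Implicit Types (x y u : R).

(** A first or second order term is absorbed by a small constant and a fourth
    order term. *)
Lemma quartic_young (A m e : R) : 0 < e -> exists2 C, 0 <= C &
  forall u, A * `|u| + m * u ^+ 2 <= e + C * u ^+ 4.
Proof.
move=> e0; pose p := A ^+ 2 / (2 * e) + m.
exists (p ^+ 2 / (2 * e)) => [|u].
  by rewrite divr_ge0 ?sqr_ge0// mulr_ge0// ltW.
have e20 : 0 < 2 * e by rewrite mulr_gt0.
have amgm a b : a * b <= e / 2 + a ^+ 2 / (2 * e) * b ^+ 2.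
  rewrite -subr_ge0 (_ : _ - _ = (e - a * b) ^+ 2 / (2 * e)).
    by rewrite divr_ge0 ?sqr_ge0// ltW.
  by field; rewrite gt_eqF.
have h1 := amgm A `|u|; have h2 := amgm p (u ^+ 2).
rewrite real_normK ?num_real// in h1; rewrite -exprM in h2.
have -> : m = p - A ^+ 2 / (2 * e) by rewrite /p; ring.
lra.
Qed.

(** A telescoping sum stopped when the decreasing condition [G] first fails.
    While [G] persists, the increments of [f] are controlled by [S] and those
    of [a]; at the one step where [G] fails only a crude lower bound on [S] is
    available, but there [f] has already gained at least [V]. *)
Lemma sum_stopped_ge (G : nat -> bool) (f a S Q : nat -> R) (N : nat)
    (f0 k K e V : R) :
  (forall i, G i.+1 -> G i) -> G 0%N -> f 0%N = f0 -> a 0%N = 0 ->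
  0 <= k -> 0 <= e -> (forall i, 0 <= Q i) ->
  (forall i, (i < N)%N -> G i.+1 ->
    f i.+1 - f i <= S i + k * (a i.+1 - a i)) ->
  (forall i, (i < N)%N -> G i -> - (e + Q i) <= S i) ->
  (forall i, (i <= N)%N -> G i -> f0 <= f i /\ a i <= K) ->
  (forall i, (i < N)%N -> G i -> ~~ G i.+1 -> V <= f i - f0) ->
  (G N -> V <= 0) ->
  V - k * K - e - \sum_(0 <= i < N) Q i <= \sum_(0 <= i < N) (G i)%:R * S i.
Proof.
move=> Gd G0 f00 a0 k0 e0 Q0 step low bnd exit VN.
have : forall n, (n <= N)%N ->
    let s := \sum_(0 <= i < n) (G i)%:R * S i in
    if G n then f n - f0 - k * a n <= s
    else V - k * K - e - \sum_(0 <= i < n) Q i <= s.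
  elim=> [_|n IH nN] /=; first by rewrite G0 !big_geq// f00 a0; lra.
  rewrite !big_nat_recr//=; have := IH (ltnW nN); rewrite /=.
  set s := \sum_(0 <= i < n) _ * _; set q := \sum_(0 <= i < n) _.
  have q0 : 0 <= q by apply: sumr_ge0.
  have Qn := Q0 n.
  have [Gn1|Gn1] := boolP (G n.+1).
    by rewrite (Gd _ Gn1) mul1r => IHn; have := step n nN Gn1; lra.
  have [Gn IHn|Gn IHn] := boolP (G n); last by rewrite mul0r; lra.
  have := low n nN Gn; have := exit n nN Gn Gn1.
  have [_ aK] := bnd n (ltnW nN) Gn; have := ler_wpM2l k0 aK.
  by rewrite mul1r; lra.
move=> /(_ N (leqnn N)) /=.
have q0 : 0 <= \sum_(0 <= i < N) Q i by apply: sumr_ge0.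
have [GN|//] := boolP (G N); have [h1 h2] := bnd N (leqnn N) GN.
have := VN GN; have := ler_wpM2l k0 h2; lra.
Qed.

(** One step from [x] to [y] of the diffusion, whose noise increment is
    [Num.sqrt 2 * db] and whose drift increment is [D]. *)
Lemma step_bound (phi psi : R -> R) (M L d h x y db D : R) :
  phi y - phi x <= psi x * (y - x) + M / 2 * (y - x) ^+ 2 ->
  `|y - x| <= d -> `|db| <= d ->
  D = (y - x) - Num.sqrt 2 * db -> 0 <= D -> (psi x - L * d) * D <= h ->
  phi y - phi x <= psi x * (Num.sqrt 2 * db) + M * db ^+ 2 + h
     + ((L + 4 * `|M|) * d) * D.
Proof.
move=> taylor yd bd DE D0 drift.
set r := Num.sqrt 2 : R; have r0 : 0 <= r by rewrite sqrtr_ge0.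
have r2 : r ^+ 2 = 2 by rewrite sqr_sqrtr.
have rle : r <= 2 by nra.
have d0 : 0 <= d by apply: le_trans bd.
have rb : `|r * db| <= 2 * d by rewrite normrM (ger0_norm r0) ler_pM.
have D3 : D <= 3 * d.
  rewrite DE; apply: le_trans (ler_norm _) _; apply: le_trans (ler_normB _ _) _.
  lra.
have yx : y - x = r * db + D by rewrite DE -/r; ring.
rewrite yx in taylor.
have quad : M / 2 * (r * db + D) ^+ 2 <= M * db ^+ 2 + 4 * `|M| * d * D.
  have -> : M / 2 * (r * db + D) ^+ 2 =
      M / 2 * r ^+ 2 * db ^+ 2 + M * ((r * db + D / 2) * D) by field.
  rewrite r2 (_ : M / 2 * 2 = M); last by field.
  rewrite lerD2l; apply: le_trans (ler_norm _) _.
  rewrite normrM (_ : 4 * `|M| * d * D = `|M| * (4 * d * D)); last by ring.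
  rewrite ler_wpM2l// normrM (ger0_norm D0) ler_wpM2r//.
  apply: le_trans (ler_normD _ _) _; rewrite (ger0_norm (_ : 0 <= D / 2)); lra.
lra.
Qed.

(** A bound at the rational times of [[s, r]] holds at all its times; the
    rationality of [r] takes care of the right endpoint. *)
Lemma rat_dense_le (f : R -> R) (s c : R) (r : rat) :
  {within `[0, +oo[, continuous f} -> 0 <= s ->
  (forall q : rat, s <= ratr q -> ratr q <= ratr r :> R -> f (ratr q) <= c) ->
  forall u, s <= u -> u <= ratr r -> f u <= c.
Proof.
move=> /subspace_continuousP cf s0 fq u su ur.
have [->|ur'] := eqVneq u (ratr r); first by apply: fq; [exact: le_trans ur|].
have {}ur' : u < ratr r by rewrite lt_neqAle ur' ur.
rewrite leNgt; apply/negP => cfu.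
have u0 : 0 <= u by exact: le_trans su.
have uA : `[0, +oo[%classic u by rewrite /= in_itv /= u0.
have /cvgrPdist_lt/(_ (f u - c)) := cf u uA; rewrite subr_gt0 => /(_ cfu).
move=> /nbhs_ballP[e /= e0 He].
have uq : u < Num.min (ratr r) (u + e) by rewrite lt_min ur' ltrDl.
have [q {uq}] := rat_in_itvoo uq.
rewrite in_itv /= lt_min => /andP[uq /andP[qr qe]].
have := He (ratr q); rewrite /ball /= distrC ger0_norm ?subr_ge0 ?ltW//.
rewrite ltrBlDl => /(_ qe); rewrite in_itv /= (le_trans u0 (ltW uq)) => /(_ erefl).
have := fq q (le_trans su (ltW uq)) (ltW qr) => h1 h2.
by have := ler_norm (f u - f (ratr q)); lra.
Qed.

End discrete_path.

Section drift.
Variable R : realType.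
Local Notation mu := (@lebesgue_measure R).

(** On a time interval where [psi (X u)] is at least [c], the drift [1 / psi]
    accumulates a nonnegative amount, at most [(t - s) / c] when [c > 0]. *)
Lemma drift_increment (a b : R) (psi X w : R -> R) (x0 c s t : R) :
  0 <= s -> s <= t -> {within `[0, +oo[, continuous X} ->
  {within `[a, b], continuous psi} -> (forall x, x \in `[a, b] -> 0 <= psi x) ->
  (forall u, 0 <= u -> u <= t -> X u \in `[a, b]) ->
  (forall u, s <= u -> u <= t -> c <= psi (X u)) ->
  ((X s)%:E = (x0 + w s)%:E +
    \int[mu]_(u in `[0%R, s]) ((psi (X u))^-1)%:E)%E ->
  ((X t)%:E = (x0 + w t)%:E +
    \int[mu]_(u in `[0%R, t]) ((psi (X u))^-1)%:E)%E ->
  let D := (X t - X s) - (w t - w s) in 0 <= D /\ c * D <= t - s.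
Proof.
move=> s0 st cX cpsi psi0 XA cX' Xs Xt D.
have t0 : 0 <= t := le_trans s0 st.
pose g u := (psi (X u))^-1.
have cg : {within `[0, t], continuous (psi \o X)}.
  apply/subspace_continuousP => u /=; rewrite in_itv /= => /andP[u0 ut].
  have uA : `[0, +oo[%classic u by rewrite /= in_itv /= u0.
  have /cvgrPdist_lt hX := (subspace_continuousP _ _).1 cX u uA.
  have /cvgrPdist_lt hp := (subspace_continuousP _ _).1 cpsi (X u) (XA u u0 ut).
  apply/cvgrPdist_lt => e /hp/nbhs_ballP[d /= d0 Hd].
  have /nbhs_ballP[d2 /= d20 Hd2] := hX d d0.
  apply/nbhs_ballP; exists d2 => // v dv; rewrite /= in_itv /= => /andP[v0 vt].
  apply: Hd; last exact: XA.
  by apply: Hd2 => //; rewrite /= in_itv /= v0.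
have g0 u : `[0, t]%classic u -> 0 <= g u.
  by rewrite /= in_itv /= => /andP[u0 ut]; rewrite invr_ge0 psi0// XA.
(* on nonnegative numbers the inverse is the power of exponent -1, which is
   measurable; this covers the value 0 at 0 *)
have mg : measurable_fun `[0, t] g.
  apply: (eq_measurable_fun (fun u => (psi (X u)) `^ (-1))).
    move=> u /[!inE] /= /[!in_itv] /= /andP[u0 ut].
    by rewrite powR_inv1// psi0// XA.
  apply: (measurableT_comp (measurable_powR _)).
  exact: subspace_continuous_measurable_fun.
have sub1 : (`[0, s] `<=` `[0, t])%classic.
  by move=> u /=; rewrite !in_itv /= => /andP[-> us]; rewrite (le_trans us st).
have sub2 : (`]s, t] `<=` `[0, t])%classic.
  move=> u /=; rewrite !in_itv /= => /andP[su ->].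
  by rewrite (le_trans s0 (ltW su)).
have split : (\int[mu]_(u in `[0%R, t]) (g u)%:E =
    \int[mu]_(u in `[0%R, s]) (g u)%:E + \int[mu]_(u in `]s, t]) (g u)%:E)%E.
  have U : `[0, t]%classic = `[0, s]%classic `|` `]s, t]%classic.
    by rewrite -itv_bndbnd_setU// bnd_simp.
  have mgU := mg; have g0U := g0; rewrite U in mgU g0U.
  rewrite U ge0_integral_setU//=.
  - exact/measurable_EFinP.
  - apply/disj_set2P/seteqP; split => // u [] /=; rewrite !in_itv /=.
    by move=> /andP[_ us] /andP[su _]; move: (lt_le_trans su us); rewrite ltxx.
have Is : (\int[mu]_(u in `[0%R, s]) (g u)%:E = (X s - (x0 + w s))%:E)%E.
  by rewrite EFinB Xs addeAC subee// add0e.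
have It : (\int[mu]_(u in `[0%R, t]) (g u)%:E = (X t - (x0 + w t))%:E)%E.
  by rewrite EFinB Xt addeAC subee// add0e.
have ID : (\int[mu]_(u in `]s, t]) (g u)%:E = D%:E)%E.
  have : ((X t - (x0 + w t))%:E - (X s - (x0 + w s))%:E = D%:E)%E.
    by rewrite -EFinB; congr EFin; rewrite /D; ring.
  by move=> <-; rewrite -It -Is split addeAC subee ?add0e// Is.
have D0 : 0 <= D.
  rewrite -lee_fin -ID; apply: integral_ge0 => u /sub2 /g0.
  by rewrite lee_fin.
split => //; have [c0|c0] := leP c 0.
  by apply: (@le_trans _ _ 0); [rewrite mulr_le0_ge0|rewrite subr_ge0].
rewrite mulrC -ler_pdivlMr// -lee_fin -ID.
apply: (@le_trans _ _ (\int[mu]_(u in `]s, t]) (c^-1)%:E)%E).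
  apply: ge0_le_integral => //=.
  - by move=> u /sub2 /g0; rewrite lee_fin.
  - by apply/measurable_EFinP; exact: measurable_funS mg.
  - move=> u; rewrite in_itv /= => /andP[su ut]; rewrite lee_fin /g.
    have := cX' u (ltW su) ut => cp.
    by rewrite lef_pV2// posrE (lt_le_trans c0 cp).
rewrite integral_cst//= lebesgue_measure_itv /=; case: ifPn => [|].
  by rewrite -EFinB -EFinM lee_fin mulrC.
by rewrite mule0 lee_fin divr_ge0 ?subr_ge0// ltW.
Qed.

End drift.

(** * Events depending on a path up to a given time *)

Section path_controls.
Variables (R : realType).

Lemma measurable_forall_countable d (T : measurableType d) (J : countType)
    (F : J -> set T) :
  (forall i, measurable (F i)) -> measurable [set w | forall i, F i w].
Proof.
move=> mF.
have -> : [set w | forall i, F i w] =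
    \bigcap_n (if unpickle n is Some i then F i else setT).
  apply/seteqP; split => w /= H; first by move=> n _; case: unpickle.
  by move=> i; have := H (pickle i) I; rewrite pickleK.
by apply: bigcapT_measurable => n; case: unpickle.
Qed.

Section sets.
Variable T : Type.
Implicit Types (Y : R -> T -> R) (t c e h : R).

(** The process [Y] is at most [c] at all rational times of [[0, t]].
    Restricting to rational times makes the event depend on countably many
    values of [Y]; on continuous paths nothing is lost. *)
Definition below c Y t : set T :=
  [set w | forall q : rat, (0 : R) <= ratr q <= t -> Y (ratr q) w <= c].

(** [Y] varies by at most [e] between rational times of [[0, t]] at distance at
    most [h]. *)
Definition small_osc e h Y t : set T :=
  [set w | forall q r : rat, (0 : R) <= ratr q <= t -> (0 : R) <= ratr r <= t ->
     `|ratr q - ratr r : R| <= h -> `|Y (ratr q) w - Y (ratr r) w| <= e].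

Lemma below_decr c Y s t : s <= t -> below c Y t `<=` below c Y s.
Proof.
by move=> st w H q /andP[q0 qs]; apply: H; rewrite q0 (le_trans qs).
Qed.

Lemma small_osc_decr e h Y s t : s <= t ->
  small_osc e h Y t `<=` small_osc e h Y s.
Proof.
move=> st w H q r /andP[q0 qs] /andP[r0 rs].
by apply: H; rewrite ?q0 ?r0 ?(le_trans qs)// (le_trans rs).
Qed.

End sets.

Variables (d : measure_display) (T : measurableType d).
Implicit Types (Y : R -> T -> R).

Lemma measurable_below c Y t :
  (forall s, 0 <= s -> s <= t -> measurable_fun setT (Y s)) ->
  measurable (below c Y t).
Proof.
move=> mY; apply: (@measurable_forall_countable _ _ _
  (fun q => [set w | (0 : R) <= ratr q <= t -> Y (ratr q) w <= c])) => q.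
have [/andP[q0 qt]|qN] := boolP ((0 : R) <= ratr q <= t); last first.
  by rewrite (_ : mkset _ = setT)//; apply/seteqP; split => // w _.
rewrite (_ : mkset _ = setT `&` [set w | Y (ratr q) w <= c]).
  by apply: measurable_fun_le => //; exact: mY.
by rewrite setTI; apply/seteqP; split => w /=; [exact|move=> + _; exact].
Qed.

Lemma measurable_small_osc e h Y t :
  (forall s, 0 <= s -> s <= t -> measurable_fun setT (Y s)) ->
  measurable (small_osc e h Y t).
Proof.
move=> mY; pose D q r w := (0 : R) <= ratr q <= t -> (0 : R) <= ratr r <= t ->
  `|ratr q - ratr r : R| <= h -> `|Y (ratr q) w - Y (ratr r) w| <= e.
apply: (@measurable_forall_countable _ _ _ (fun q => [set w | forall r, D q r w])) => q.
apply: (@measurable_forall_countable _ _ _ (fun r => [set w | D q r w])) => r.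
rewrite {}/D.
have [/andP[q0 qt]|qN] := boolP ((0 : R) <= ratr q <= t); last first.
  by rewrite (_ : mkset _ = setT)//; apply/seteqP; split => // w _.
have [/andP[r0 rt]|rN] := boolP ((0 : R) <= ratr r <= t); last first.
  by rewrite (_ : mkset _ = setT)//; apply/seteqP; split => // w _.
have [qr|qr] := boolP (`|ratr q - ratr r : R| <= h); last first.
  by rewrite (_ : mkset _ = setT)//; apply/seteqP; split => // w _.
rewrite (_ : mkset _ =
    setT `&` [set w | `|Y (ratr q) w - Y (ratr r) w| <= e]).
  apply: measurable_fun_le => //; apply: measurableT_comp => //.
  by apply: measurable_funB; exact: mY.
by rewrite setTI; apply/seteqP; split => w /=; [exact|move=> + _ _ _; exact].
Qed.

End path_controls.

Section limits.
Variables (R : realType) (d : measure_display) (T : measurableType d).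
Variable (P : probability T R).

Lemma probability_increasing_cover (A : nat -> set T) (e : R) : 0 < e ->
  (forall n, measurable (A n)) -> (forall n m, (n <= m)%N -> A n `<=` A m) ->
  {ae P, forall w, exists n, A n w} ->
  exists n, 1 - e <= fine (P (A n)).
Proof.
move=> e0 mA Am cov.
have mU : measurable (\bigcup_n A n) by exact: bigcupT_measurable.
have PU : P (\bigcup_n A n) = 1%E.
  have [N [mN PN sub]] := cov.
  apply/eqP; rewrite eq_le probability_le1//=.
  rewrite -(_ : P (~` N) = 1%E); last by rewrite probability_setC// PN sube0.
  apply: le_measure; rewrite ?inE//; first exact: measurableC.
  move=> w Nw; apply: contrapT => Uw; apply/Nw/sub => /= -[n An].
  by apply: Uw; exists n.
have : P \o A @ \oo --> 1%E.
  rewrite -PU; apply: nondecreasing_cvg_mu => //.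
  by move=> n m nm; apply/subsetPset; exact: Am.
move=> /fine_cvgP[_ /cvgrPdist_le/(_ e e0)[N _ /(_ N (leqnn N))]] /=.
move=> H; exists N; have := ler_norm (1 - fine (P (A N))); lra.
Qed.

(** A lower bound for the integral of [g] that does not need [g] to be
    measurable: the integral of a nonnegative function is a supremum over the
    simple functions below it. *)
Lemma ge0_integral_ge (f : T -> R) (g : T -> \bar R) (a : R) :
  has_mean P f a -> (forall w, 0 <= g w)%E ->
  {ae P, forall w, ((f w)%:E <= g w)%E} -> (a%:E <= \int[P]_w g w)%E.
Proof.
move=> fa g0 [N [mN PN sub]]; have mf := has_mean_measurable fa.
pose f' w := Num.max 0 (f w) * \1_(~` N) w.
have f'0 w : 0 <= f' w by rewrite mulr_ge0// le_max lexx.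
have mf' : measurable_fun setT f'.
  apply: measurable_funM; first exact: measurable_maxr.
  by apply: measurable_indic; exact: measurableC.
have f'g w : ((f' w)%:E <= g w)%E.
  rewrite /f' indicE; have [wN|wN] := boolP (w \in ~` N); last by rewrite mulr0.
  rewrite mulr1 EFin_max ge_max g0 /=; apply: contrapT => fg.
  by move: wN; rewrite inE; apply; exact: sub.
have if' : P.-integrable setT (EFin \o f').
  have [fi _] := fa; apply: le_integrable fi => //; first exact/measurable_EFinP.
  move=> w _ /=; rewrite lee_fin (ger0_norm (f'0 w)) /f' indicE.
  have [_|_] := boolP (w \in ~` N); last by rewrite mulr0.
  by rewrite mulr1 ge_max normr_ge0 ler_norm.
have f'b : has_mean P f' (fine (\int[P]_w (f' w)%:E)).
  by split => //; rewrite fineK//; exact: integrable_fin_num.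
apply: (@le_trans _ _ (\int[P]_w (f' w)%:E)%E).
  have [_ ->] := f'b; rewrite lee_fin; apply: has_mean_ae_le fa f'b _.
  exists N; split => // w /= fw; apply: contrapT => Nw; apply: fw.
  by rewrite /f' indicE mem_set// mulr1 le_max lexx orbT.
rewrite !ge0_integralTE//; apply: le_ereal_sup => _ [h /= hf' <-].
by exists h => // w; exact: le_trans (hf' w) (f'g w).
Qed.

End limits.

(** * Good paths of the diffusion *)

Lemma hitting_time_ge0 (R : realType) (T : Type) (X : R -> T -> R) (a : R) w :
  (0 <= hitting_time X a w)%E.
Proof.
by apply: le_ereal_inf_tmp => _ [v [v0 _] <-]; rewrite lee_fin.
Qed.

Section good_paths.
Variables (R : realType) (phi : R -> R) (M L C : R).
Local Notation A := (`[0, pi]%classic).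
Local Notation psi := (deriv_on A phi).
Hypothesis taylor : forall x y, x \in `[0, pi] -> y \in `[0, pi] ->
  phi y - phi x <= psi x * (y - x) + M / 2 * (y - x) ^+ 2.
Hypothesis psi_ge0 : forall x, x \in `[0, pi] -> 0 <= psi x.
Hypothesis psi_lip : forall x y, x \in `[0, pi] -> y \in `[0, pi] ->
  `|psi y - psi x| <= L * `|y - x|.
Hypothesis phi_lip : forall x y, x \in `[0, pi] -> y \in `[0, pi] ->
  `|phi y - phi x| <= C * `|y - x|.
Hypothesis psi_cont : {within A, continuous psi}.
Hypothesis phi_nd : forall x y, x \in `[0, pi] -> y \in `[0, pi] ->
  x <= y -> phi x <= phi y.
Hypotheses (L0 : 0 <= L) (C0 : 0 <= C).

Variables (T : Type) (B X : R -> T -> R).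

(** The properties that almost all paths of the diffusion have. *)
Definition good_path (w : T) :=
  [/\ {within `[0, +oo[, continuous (fun t => X t w)},
      {within `[0, +oo[, continuous (fun t => B t w)},
      X 0 w = 0, B 0 w = 0 &
      forall t, 0 <= t -> (t%:E <= hitting_time X pi w)%E ->
        X t w \in `[0, pi] /\
        (X t w)%:E = ((X 0 w + Num.sqrt 2 * B t w)%:E +
          \int[lebesgue_measure]_(s in `[0%R, t])
             ((psi (X s w))^-1)%:E)%E].

Variables (n m : nat) (e K : R).
Hypotheses (e0 : 0 < e) (e_pi : e <= pi) (K0 : 0 <= K).

Let h : R := m.+1%:R^-1.
Let N := (n * m.+1)%N.

(** The [i]-th point of the time grid of mesh [m.+1%:R^-1]; the last one used
    is the [N]-th, which is [n]. *)
Definition grid (i : nat) : R := i%:R / m.+1%:R.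

Let h0 : 0 < h. Proof. by rewrite invr_gt0. Qed.

Lemma gridE i : grid i = ratr (i%:R / m.+1%:R).
Proof. by rewrite /grid rmorphM /= fmorphV /= !ratr_nat. Qed.

Lemma grid_ge0 i : 0 <= grid i. Proof. by rewrite divr_ge0. Qed.

Lemma grid0 : grid 0 = 0. Proof. by rewrite /grid mul0r. Qed.

Lemma gridS i : grid i.+1 - grid i = h.
Proof. by rewrite /grid -mulrBl -addn1 natrD addrAC subrr add0r mul1r. Qed.

Lemma grid_le i j : (i <= j)%N -> grid i <= grid j.
Proof. by move=> ij; rewrite ler_wpM2r ?invr_ge0// ler_nat. Qed.

Lemma gridN : grid N = n%:R.
Proof. by rewrite /grid natrM mulfK. Qed.

(** Before the hitting time of [pi], this is the nondecreasing process
    obtained by integrating the drift along the path. *)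
Definition drift_part t w := X t w - Num.sqrt 2 * B t w.

(** Up to time [t] the path stays at distance at least [e] from [pi], its drift
    part stays below [K], and the path and the noise vary by at most [e] over
    each mesh. *)
Definition controlled t : set T :=
  (below (pi - e) X t `&` below K drift_part t) `&`
  (small_osc e h X t `&` small_osc e h B t).

Lemma controlled_decr s t : s <= t -> controlled t `<=` controlled s.
Proof.
move=> st w [[a b] [c d]]; split; split.
- exact: below_decr a.
- exact: below_decr b.
- exact: small_osc_decr c.
- exact: small_osc_decr d.
Qed.

Section path.
Variables (w : T) (gw : good_path w).


Lemma below_hitting (r : rat) u : below (pi - e) X (ratr r) w ->
  0 <= u -> u <= ratr r ->
  X u w <= pi - e /\ (u%:E <= hitting_time X pi w)%E.
Proof.
move=> bw; have [cX _ _ _ _] := gw.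
have lt v : 0 <= v -> v <= ratr r -> X v w <= pi - e.
  apply: (@rat_dense_le _ (fun t => X t w)) => // q q0 qr.
  by apply: bw; rewrite q0.
move=> u0 ur; split; first exact: lt.
apply: le_ereal_inf_tmp => _ [v [v0 Xv] <-]; rewrite lee_fin leNgt.
apply/negP => vu; have := lt v v0 (le_trans (ltW vu) ur); rewrite Xv; have := e0; lra.
Qed.

Lemma controlled_in i : controlled (grid i) w ->
  X (grid i) w \in `[0, pi] /\ ((grid i)%:E <= hitting_time X pi w)%E.
Proof.
move=> [[bX _] _]; have [_ _ _ _ eqn] := gw; rewrite gridE in bX *.
have r0 : (0 : R) <= ratr (i%:R / m.+1%:R) by rewrite -gridE grid_ge0.
by have [_ hit] := below_hitting bX r0 (lexx _); split => //; have [] := eqn _ r0 hit.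
Qed.

(** The increment of the noise over the [i]-th step. *)
Definition gridB i := B (grid i.+1) w - B (grid i) w.

(** The gain of [phi] over a step throughout which the path is controlled; the
    error is [O(e)] times the increment of the drift part, and these
    increments add up to at most [K]. *)
Lemma controlled_step i : controlled (grid i.+1) w ->
  phi (X (grid i.+1) w) - phi (X (grid i) w) <=
  psi (X (grid i) w) * (Num.sqrt 2 * gridB i) + M * gridB i ^+ 2 + h +
  ((L + 4 * `|M|) * e) * (drift_part (grid i.+1) w - drift_part (grid i) w).
Proof.
move=> cw; have [cX cB X0 B0 eqn] := gw.
have ii : grid i <= grid i.+1 by exact: grid_le.
have [Xt hitt] := controlled_in cw.
have [Xs hits] := controlled_in (controlled_decr ii cw).
have [[bX _] [oX oB]] := cw.
have inA u : 0 <= u -> u <= grid i.+1 -> X u w \in `[0, pi].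
  move=> u0 ui; rewrite gridE in ui bX.
  by have [_ hit] := below_hitting bX u0 ui; have [] := eqn _ u0 hit.
have osc (Y : R -> T -> R) : small_osc e h Y (grid i.+1) w ->
    forall q : rat, grid i <= ratr q -> ratr q <= grid i.+1 ->
    `|Y (ratr q) w - Y (grid i) w| <= e.
  move=> oY q qi qi1; rewrite gridE; apply: oY.
  - by rewrite (le_trans (grid_ge0 i) qi).
  - by rewrite -gridE grid_ge0.
  - rewrite -gridE ger0_norm ?subr_ge0// -(gridS i); lra.
have close u : grid i <= u -> u <= grid i.+1 -> `|X u w - X (grid i) w| <= e.
  rewrite (gridE i.+1); apply: (@rat_dense_le _ (fun t => `|X t w - X (grid i) w|)).
  - move=> t; apply: cvg_norm; apply: cvgB; [exact: cX|exact: cvg_cst].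
  - exact: grid_ge0.
  - by move=> q; rewrite -gridE; exact: osc.
have low u : grid i <= u -> u <= grid i.+1 ->
    psi (X (grid i) w) - L * e <= psi (X u w).
  move=> iu ui; have Xu := inA u (le_trans (grid_ge0 i) iu) ui.
  have := psi_lip Xs Xu; have := close u iu ui => h1 h2.
  have := ler_wpM2l L0 h1; have := ler_norm (psi (X (grid i) w) - psi (X u w)).
  rewrite distrC; lra.
have [] := @drift_increment _ 0 pi psi (fun t => X t w)
  (fun t => Num.sqrt 2 * B t w) (X 0 w) (psi (X (grid i) w) - L * e)
  (grid i) (grid i.+1) (grid_ge0 i) ii cX psi_cont psi_ge0 inA low
  (eqn _ (grid_ge0 i) hits).2 (eqn _ (grid_ge0 i.+1) hitt).2.
rewrite gridS => D0 D1.
have DE : drift_part (grid i.+1) w - drift_part (grid i) w =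
    X (grid i.+1) w - X (grid i) w - Num.sqrt 2 * gridB i.
  by rewrite /drift_part /gridB; ring.
have DE' : X (grid i.+1) w - X (grid i) w -
    (Num.sqrt 2 * B (grid i.+1) w - Num.sqrt 2 * B (grid i) w) =
    drift_part (grid i.+1) w - drift_part (grid i) w.
  by rewrite /drift_part; ring.
rewrite DE' in D0 D1.
apply: step_bound D0 D1 => //.
- exact: taylor.
- exact: close.
- have := osc B oB (i.+1%:R / m.+1%:R); rewrite -gridE; exact.
Qed.

(** The sum over the steps begun under control is at least about
    [phi pi - phi 0], except when the drift part or the oscillations are too
    large on [[0, n]] or the path is still controlled at time [n]: in those
    cases the factor of [phi pi - phi 0] is nonpositive.  Otherwise control is
    lost because the path comes within [e] of [pi]. *)
Lemma good_path_sum (eta Ce : R) : 0 <= eta -> 0 <= Ce ->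
  (forall x, x \in `[0, pi] -> forall u,
     - (eta + Ce * u ^+ 4) <= psi x * (Num.sqrt 2 * u) + M * u ^+ 2) ->
  (phi pi - phi 0) * (\1_(below K drift_part n%:R) w +
    \1_(small_osc e h X n%:R `&` small_osc e h B n%:R) w - 1 -
    \1_(controlled n%:R) w)
  - C * (2 * e) - ((L + 4 * `|M|) * e) * K - eta
  - \sum_(0 <= i < N) Ce * gridB i ^+ 4 <=
  \sum_(0 <= i < N) \1_(controlled (grid i)) w *
     (psi (X (grid i) w) * (Num.sqrt 2 * gridB i) + M * gridB i ^+ 2 + h).
Proof.
move=> eta0 Ce0 young; have [cX cB X0 B0 eqn] := gw.
have pi0 : 0 <= pi :> R by exact: pi_ge0.
have zA : (0 : R) \in `[0, pi] by rewrite in_itv /= lexx.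
have pA : (pi : R) \in `[0, pi] by rewrite in_itv /= lexx andbT.
have phipi : 0 <= phi pi - phi 0 by rewrite subr_ge0 phi_nd.
set I1 := \1_(below _ _ _) w; set I2 := \1_(_ `&` _) w; set I3 := \1_(controlled n%:R) w.
have ind01 (D : set T) : 0 <= (\1_D w : R) <= 1.
  by rewrite !indicE; case: (_ \in _); rewrite ?lexx ?ler01.
have /andP[I10 I11] := ind01 (below K drift_part n%:R).
have /andP[I20 I21] := ind01 (small_osc e h X n%:R `&` small_osc e h B n%:R).
have /andP[I30 I31] := ind01 (controlled n%:R).
rewrite -/I1 in I10 I11; rewrite -/I2 in I20 I21; rewrite -/I3 in I30 I31.
pose G i := w \in controlled (grid i).
have Gd i : G i.+1 -> G i.
  by rewrite /G !inE; apply: controlled_decr; exact: grid_le.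
under [leRHS]eq_bigr do rewrite indicE -/(G _).
apply: (@sum_stopped_ge _ G (fun i => phi (X (grid i) w))
  (fun i => drift_part (grid i) w) _ _ N (phi 0)) => //.
- rewrite /G inE grid0.
  have q0 (q : rat) : (0 : R) <= ratr q <= (0 : R) -> ratr q = 0 :> R.
    by move=> /andP[q1 q2]; apply: le_anti; rewrite q1 q2.
  split; split.
  + by move=> q /q0 ->; rewrite X0 subr_ge0.
  + by move=> q /q0 ->; rewrite /drift_part X0 B0 mulr0 subr0.
  + by move=> q r /q0 -> /q0 -> _; rewrite subrr normr0 ltW.
  + by move=> q r /q0 -> /q0 -> _; rewrite subrr normr0 ltW.
- by rewrite grid0 X0.
- by rewrite /drift_part grid0 X0 B0 mulr0 subr0.
- by rewrite mulr_ge0 ?(ltW e0)// addr_ge0// mulr_ge0.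
- by move=> i; rewrite mulr_ge0// exprn_even_ge0.
- by move=> i iN; rewrite /G inE => /controlled_step.
- move=> i iN; rewrite /G inE => /controlled_in[Xi _].
  by have := young _ Xi (gridB i); have := h0; lra.
- move=> i iN; rewrite /G inE => ci; have [Xi _] := controlled_in ci.
  split; first by apply: phi_nd => //; move: Xi; rewrite in_itv /= => /andP[].
  have [[_ bK] _] := ci; rewrite (gridE i); apply: bK.
  by rewrite -gridE grid_ge0 /=.
- move=> i iN; rewrite /G !inE => ci /negP; rewrite inE => nci.
  have [Xi _] := controlled_in ci.
  have Xi0 : 0 <= phi (X (grid i) w) - phi 0.
    by rewrite subr_ge0 phi_nd//; move: Xi; rewrite in_itv /= => /andP[].
  have Ce20 : 0 <= C * (2 * e) by rewrite mulr_ge0// mulr_ge0// ltW.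
  have [H|nH] := boolP (w \in below K drift_part n%:R); last first.
    have I1E : I1 = 0 by rewrite /I1 indicE (negbTE nH).
    have : (phi pi - phi 0) * (I1 + I2 - 1 - I3) <= 0.
      by rewrite mulr_ge0_le0//; lra.
    lra.
  have [J|nJ] := boolP (w \in small_osc e h X n%:R `&` small_osc e h B n%:R); last first.
    have I2E : I2 = 0 by rewrite /I2 indicE (negbTE nJ).
    have : (phi pi - phi 0) * (I1 + I2 - 1 - I3) <= 0.
      by rewrite mulr_ge0_le0//; lra.
    lra.
  have iN' : grid i.+1 <= n%:R by rewrite -gridN; exact: grid_le.
  rewrite !inE in H J.
  (* neither the drift part nor the oscillations are to blame, so the path has
     exceeded [pi - e] during this step *)
  have [q [q0 qi qX]] : exists q : rat, [/\ (0 : R) <= ratr q,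
      ratr q <= grid i.+1 & pi - e < X (ratr q) w].
    apply: contrapT => nq; apply: nci; split; last first.
      by case: J => J1 J2; split; exact: small_osc_decr iN' _ _.
    split; last exact: below_decr iN' _ H.
    move=> q /andP[q0 qi]; rewrite leNgt; apply/negP => qX; apply: nq.
    by exists q.
  have iq : grid i < ratr q.
    rewrite ltNge; apply/negP => qi'; have [[bX _] _] := ci.
    by have := bX q; rewrite q0 qi' => /(_ erefl); lra.
  have Xq : `|X (ratr q) w - X (grid i) w| <= e.
    case: J => + _; rewrite (gridE i); apply.
    - by rewrite q0 (le_trans qi).
    - by rewrite -gridE grid_ge0 (le_trans (grid_le (leqnSn i))).
    - rewrite -gridE ger0_norm ?subr_ge0 ?(ltW iq)// -(gridS i); lra.
  have Xi2 : pi - X (grid i) w <= 2 * e.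
    by have := ler_norm (X (ratr q) w - X (grid i) w); lra.
  have := phi_lip Xi pA; rewrite (ger0_norm (_ : 0 <= pi - _)); last first.
    by rewrite subr_ge0; move: Xi; rewrite in_itv /= => /andP[].
  have := ler_wpM2l C0 Xi2; have := ler_norm (phi pi - phi (X (grid i) w)).
  have : (phi pi - phi 0) * (I1 + I2 - 1 - I3) <= phi pi - phi 0.
    rewrite -[leRHS]mulr1 ler_wpM2l//; lra.
  lra.
- rewrite /G gridN => GN.
  have I3E : I3 = 1 by rewrite /I3 indicE GN.
  have Ce20 : 0 <= C * (2 * e) by rewrite mulr_ge0// mulr_ge0// ltW.
  have : (phi pi - phi 0) * (I1 + I2 - 1 - I3) <= 0.
    by rewrite mulr_ge0_le0//; lra.
  lra.
Qed.

(** The time spent under control is at most the hitting time plus one mesh. *)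
Lemma good_path_count k :
  (((\sum_(0 <= i < k) \1_(controlled (grid i)) w - 1) * h)%:E <=
    hitting_time X pi w)%E.
Proof.
have tau0 := hitting_time_ge0 X pi w.
elim: k => [|k IH].
  by rewrite big_geq// sub0r mulN1r (le_trans _ tau0)// lee_fin lerNl oppr0 ltW.
rewrite big_nat_recr//= indicE; have [wk|wk] := boolP (w \in controlled (grid k)).
  have [_] := controlled_in (set_mem wk); apply: le_trans; rewrite lee_fin.
  rewrite addrK /grid ler_wpM2r// ?(ltW h0)//.
  apply: (@le_trans _ _ (\sum_(0 <= i < k) 1)); last first.
    by rewrite big_const_nat iter_addr subn0 addr0.
  apply: ler_sum => i _; rewrite indicE; case: (_ \in _); rewrite ?lexx ?ler01//.
by rewrite addr0.
Qed.

Lemma good_path_survive :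
  ((n%:R * \1_(controlled n%:R) w)%:E <= hitting_time X pi w)%E.
Proof.
have tau0 := hitting_time_ge0 X pi w.
rewrite indicE; have [wk|wk] := boolP (w \in controlled n%:R); last by rewrite mulr0.
by rewrite mulr1 -gridN in wk *; have [] := controlled_in (set_mem wk).
Qed.

End path.
End good_paths.

(** * Expectations along the grid *)

Section adapted_measurability.
Context (R : realType) (d : measure_display) (T : measurableType d).
Variables (F : R -> set (set T)).
Hypothesis filF : is_filtration F.

(** [Y] is known at time [s]. *)
Definition adapted_at (s : R) (Y : T -> R) : Prop :=
  forall S : set R, measurable S -> F s (Y @^-1` S).

(** Being known at time [s] is measurability for the sigma-algebra [F s], so
    that closure properties of measurable functions apply. *)
Lemma adapted_atE s (Y : T -> R) : 0 <= s ->
  measurable_fun setT (Y : g_sigma_algebraType (F s) -> R) <-> adapted_at s Y.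
Proof.
move=> s0; have [sF _ _] := filF; have E := sigma_algebra_id (sF s s0).
split=> [mY S mS|aY _ S mS].
  by have := mY measurableT S mS; rewrite setTI /measurable /= E.
by rewrite setTI /measurable /= E; exact: aY.
Qed.

Lemma adapted_at_measurable s Y : 0 <= s -> adapted_at s Y ->
  measurable_fun setT Y.
Proof.
by move=> s0 aY _ S mS; rewrite setTI; have [_ sub _] := filF; exact/(sub s s0)/aY.
Qed.

Lemma adapted_at_le s t Y : 0 <= s -> s <= t -> adapted_at s Y -> adapted_at t Y.
Proof. by move=> s0 st aY S mS; have [_ _ mono] := filF; exact/(mono s t s0 st)/aY. Qed.

End adapted_measurability.

(** Moments of a Brownian increment weighted by a nonnegative variable [Y]
    known at its beginning. *)
Section brownian_increments.
Context (R : realType) (d : measure_display) (T : measurableType d)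
  (P : probability T R).
Variables (F : R -> set (set T)) (B : R -> T -> R).
Hypothesis bmB : brownian_motion P F B.
Variables (s t : R) (Y : T -> R) (c : R).
Hypotheses (s0 : 0 <= s) (st : s < t).
Hypotheses (aY : adapted_at F s Y) (Y0 : forall w, 0 <= Y w).
Hypothesis Yc : has_mean P Y c.

Let dB w := B t w - B s w.

Let mdB : measurable_fun setT dB.
Proof.
have [fF aB _ _ _] := bmB; have t0 : 0 <= t := ltW (le_lt_trans s0 st).
apply: measurable_funB.
  by apply: (adapted_at_measurable fF t0) => S; exact: aB.
by apply: (adapted_at_measurable fF s0) => S; exact: aB.
Qed.

Let mY : measurable_fun setT Y.
Proof. by have [fF _ _ _ _] := bmB; exact: adapted_at_measurable aY. Qed.

Let Ymixin := isMeasurableFun.Build _ _ _ _ _ mY.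
Let Ym : {mfun T >-> R} := HB.pack Y Ymixin.
Let dBmixin := isMeasurableFun.Build _ _ _ _ _ mdB.
Let dBm : {mfun T >-> R} := HB.pack dB dBmixin.

Let ts0 : 0 < t - s. Proof. by rewrite subr_gt0. Qed.

Let indep (S U : set R) : measurable S -> measurable U ->
  P (Ym @^-1` S `&` dBm @^-1` U) =
  (P (Ym @^-1` S) * normal_prob 0 (Num.sqrt (t - s)) U)%E.
Proof.
by move=> mS mU; have [_ _ _ _ H] := bmB; apply: H => //; exact: aY.
Qed.

Lemma has_mean_increment : has_mean P (fun w => Y w * dB w) 0.
Proof. exact: (@has_mean_normal_linear _ _ _ P Ym dBm _ ts0 indep Y0 c Yc). Qed.

Lemma has_mean_increment_sqr :
  has_mean P (fun w => Y w * dB w ^+ 2) (c * (t - s)).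
Proof. exact: (@has_mean_normal_sqr _ _ _ P Ym dBm _ ts0 indep Y0 c Yc). Qed.

Lemma has_mean_increment_pow4 : exists2 b,
  has_mean P (fun w => Y w * dB w ^+ 4) b & b <= c * (128 * (t - s) ^+ 2).
Proof. exact: (@has_mean_normal_pow4 _ _ _ P Ym dBm _ ts0 indep Y0 c Yc). Qed.

End brownian_increments.

Section controlled_measurability.
Context (R : realType) (d : measure_display) (T : measurableType d).
Variables (B X : R -> T -> R) (m : nat) (e K t : R).
Hypothesis mX : forall s, 0 <= s -> s <= t -> measurable_fun setT (X s).
Hypothesis mB : forall s, 0 <= s -> s <= t -> measurable_fun setT (B s).

Lemma measurable_below_drift_part : measurable (below K (drift_part B X) t).
Proof.
apply: measurable_below => s s0 st; apply: measurable_funB; first exact: mX.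
by apply: measurable_funM => //; exact: mB.
Qed.

Lemma measurable_small_oscI h :
  measurable (small_osc e h X t `&` small_osc e h B t).
Proof. by apply: measurableI; exact: measurable_small_osc. Qed.

Lemma measurable_controlled : measurable (controlled B X m e K t).
Proof.
apply: measurableI; last exact: measurable_small_oscI.
apply: measurableI; last exact: measurable_below_drift_part.
exact: measurable_below.
Qed.

End controlled_measurability.

Section mean_inequality.
Variables (R : realType) (phi : R -> R) (M L C Cpsi : R).
Local Notation A := (`[0, pi]%classic).
Local Notation psi := (deriv_on A phi).
Hypothesis taylor : forall x y, x \in `[0, pi] -> y \in `[0, pi] ->
  phi y - phi x <= psi x * (y - x) + M / 2 * (y - x) ^+ 2.
Hypothesis psi_ge0 : forall x, x \in `[0, pi] -> 0 <= psi x.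
Hypothesis psi_le : forall x, x \in `[0, pi] -> psi x <= Cpsi.
Hypothesis psi_lip : forall x y, x \in `[0, pi] -> y \in `[0, pi] ->
  `|psi y - psi x| <= L * `|y - x|.
Hypothesis phi_lip : forall x y, x \in `[0, pi] -> y \in `[0, pi] ->
  `|phi y - phi x| <= C * `|y - x|.
Hypothesis psi_cont : {within A, continuous psi}.
Hypothesis phi_nd : forall x y, x \in `[0, pi] -> y \in `[0, pi] ->
  x <= y -> phi x <= phi y.
Hypotheses (L0 : 0 <= L) (C0 : 0 <= C).

Context (d : measure_display) (T : measurableType d) (P : probability T R).
Variables (F : R -> set (set T)) (B X : R -> T -> R).
Hypothesis X_diff : diffusion_from0 phi P F B X.

Lemma ae_good_path : {ae P, forall w, good_path phi B X w}.
Proof.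
have [[_ _ B0 cB _] _ cX X0 eqn] := X_diff.
apply: filterS (filterI (filterI B0 cB) (filterI (filterI cX X0) eqn)).
by move=> w [[? ?] [[? ?] ?]]; split.
Qed.

Variables (n m : nat) (e K : R).
Hypotheses (e0 : 0 < e) (e_pi : e <= pi) (K0 : 0 <= K).

Let h : R := m.+1%:R^-1.
Let N := (n * m.+1)%N.
Local Notation grid := (grid R m).
Local Notation ctl := (controlled B X m e K).
Local Notation drift_part := (drift_part B X).

Let h0 : 0 < h. Proof. by rewrite invr_gt0. Qed.

Let filF : is_filtration F. Proof. by have [[]] := X_diff. Qed.
Let aB t : 0 <= t -> adapted_at F t (B t).
Proof. by have [[_ aB _ _ _] _ _ _ _] := X_diff; exact: aB. Qed.
Let aX t : 0 <= t -> adapted_at F t (X t).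
Proof. by have [_ aX _ _ _] := X_diff; exact: aX. Qed.

Let mB t : 0 <= t -> measurable_fun setT (B t).
Proof. by move=> t0; exact: adapted_at_measurable (aB t0). Qed.

Let mX t : 0 <= t -> measurable_fun setT (X t).
Proof. by move=> t0; exact: adapted_at_measurable (aX t0). Qed.

Let mctl t : measurable (ctl t).
Proof. by apply: measurable_controlled => s s0 _; [exact: mX|exact: mB]. Qed.

(* [psi] is only known to be continuous on [[0, pi]]; it is cut off outside to
   get a Borel function. *)
Let psi0 := psi \_ A.

Let measurable_psi0 : measurable_fun setT psi0.
Proof.
apply/(measurable_restrictT _ _).1 => //.
exact: subspace_continuous_measurable_fun.
Qed.

Let psi0_ge0 x : 0 <= psi0 x.
Proof.
by rewrite /psi0 patchE; case: ifPn => [|_]; [rewrite inE => /psi_ge0|exact: lexx].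
Qed.

Let psi0_le x : psi0 x <= `|Cpsi|.
Proof.
rewrite /psi0 patchE; case: ifPn => [|_]; last exact: normr_ge0.
rewrite inE => /psi_le.
by move=> /le_trans; apply; exact: ler_norm.
Qed.

(* the weight of the i-th Brownian increment is known at the i-th grid time *)
Let weight i w := \1_(ctl (grid i)) w * psi0 (X (grid i) w).

Let adapted_on_grid t : 0 <= t ->
  adapted_at F t (\1_(ctl t) : T -> R) /\
  adapted_at F t (fun w => \1_(ctl t) w * psi0 (X t w)).
Proof.
move=> t0; pose T' := g_sigma_algebraType (F t).
have mY (Y : R -> T -> R) : (forall s, 0 <= s -> adapted_at F s (Y s)) ->
    forall s, 0 <= s -> s <= t -> measurable_fun setT (Y s : T' -> R).
  by move=> aY s s0 st; apply/(adapted_atE filF _ t0)/(adapted_at_le filF s0 st)/aY.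
have mG := @measurable_controlled R _ T' B X m e K t (mY X aX) (mY B aB).
have mI : measurable_fun setT (\1_(ctl t) : T' -> R) by exact: measurable_indic.
split; apply/(adapted_atE filF _ t0) => //.
apply: measurable_funM => //; apply: measurableT_comp => //.
exact: (mY X aX).
Qed.

(* the probability of being under control at the [i]-th grid time *)
Let p i := fine (P (ctl (grid i))).

Let has_mean_ctl i : has_mean P (\1_(ctl (grid i))) (p i).
Proof. exact/has_mean_indic/mctl. Qed.

Let grid_lt i : grid i < grid i.+1.
Proof. by rewrite -subr_gt0 gridS. Qed.

Let has_mean_weight i : exists c, has_mean P (weight i) c.
Proof.
have aw := (adapted_on_grid (grid_ge0 R m i)).2.
have mw := adapted_at_measurable filF (grid_ge0 R m i) aw.
have iw : P.-integrable setT (EFin \o weight i).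
  have [iC _] := has_mean_cst P `|Cpsi|; apply: le_integrable iC => //.
    exact/measurable_EFinP.
  move=> w _ /=; rewrite lee_fin normr_id /weight indicE.
  case: (_ \in _); rewrite ?mul0r ?mul1r ?normr0// ger0_norm//.
exists (fine (\int[P]_w (weight i w)%:E)); split => //.
by rewrite fineK//; exact: integrable_fin_num.
Qed.

Let step_term i w := \1_(ctl (grid i)) w *
  (psi0 (X (grid i) w) * (Num.sqrt 2 * gridB B m w i) +
   M * gridB B m w i ^+ 2 + h).

(** Given the past, the noise increment has mean [0] and variance [h]: only the
    drift [h] and the second order term [M * h] survive. *)
Lemma has_mean_step i : has_mean P (step_term i) ((1 + M) * (h * p i)).
Proof.
have [bmB _ _ _ _] := X_diff.
have [aI aw] := adapted_on_grid (grid_ge0 R m i).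
have [c wc] := has_mean_weight i.
have I0 w : 0 <= (\1_(ctl (grid i)) w : R) by rewrite indicE.
have w0 w : 0 <= weight i w by rewrite mulr_ge0.
have h1 := has_mean_increment bmB (grid_ge0 R m i) (grid_lt i) aw w0 wc.
have h2 := has_mean_increment_sqr bmB (grid_ge0 R m i) (grid_lt i) aI I0 (has_mean_ctl i).
have h3 := has_mean_add (has_mean_add (has_mean_scale (Num.sqrt 2) h1)
  (has_mean_scale M h2)) (has_mean_scale h (has_mean_ctl i)).
apply: has_mean_eq h3 _ _.
  by move=> w; rewrite /step_term /weight /gridB; ring.
by rewrite gridS -/h; ring.
Qed.

Let has_mean_quartic (Ce : R) i : 0 <= Ce -> exists2 b,
  has_mean P (fun w => Ce * gridB B m w i ^+ 4) b & b <= Ce * (128 * h ^+ 2).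
Proof.
move=> Ce0; have [bmB _ _ _ _] := X_diff.
have a1 : adapted_at F (grid i) (fun=> 1 : R).
  apply/(adapted_atE filF _ (grid_ge0 R m i)); exact: measurable_cst.
have [b hb bl] := has_mean_increment_pow4 bmB (grid_ge0 R m i) (grid_lt i) a1
  (fun _ => ler01) (has_mean_cst P 1).
exists (Ce * b); last by rewrite ler_wpM2l//; move: bl; rewrite gridS mul1r.
apply: has_mean_eq (has_mean_scale Ce hb) _ _ => // w.
by rewrite mul1r.
Qed.

(** The expectation of [good_path_sum]. *)
Lemma mean_inequality (eta Ce : R) : 0 <= eta -> 0 <= Ce ->
  (forall x, x \in `[0, pi] -> forall u,
     - (eta + Ce * u ^+ 4) <= psi x * (Num.sqrt 2 * u) + M * u ^+ 2) ->
  (phi pi - phi 0) * (fine (P (below K drift_part n%:R)) +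
    fine (P (small_osc e h X n%:R `&` small_osc e h B n%:R)) - 1 -
    fine (P (ctl n%:R)))
  - C * (2 * e) - ((L + 4 * `|M|) * e) * K - eta
  - N%:R * (Ce * (128 * h ^+ 2)) <=
  (1 + M) * \sum_(0 <= i < N) (h * p i).
Proof.
move=> eta0 Ce0 young.
have mH : measurable (below K drift_part n%:R).
  by apply: measurable_below_drift_part => s s0 _; [exact: mX|exact: mB].
have mJ : measurable (small_osc e h X n%:R `&` small_osc e h B n%:R).
  by apply: measurable_small_oscI => s s0 _; [exact: mX|exact: mB].
have hR : has_mean P (fun w => \sum_(0 <= i < N) step_term i w)
    ((1 + M) * \sum_(0 <= i < N) (h * p i)).
  by rewrite mulr_sumr; apply: has_mean_sum => i _; exact: has_mean_step.
pose b i := sval (cid2 (has_mean_quartic i Ce0)).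
have bM i : has_mean P (fun w => Ce * gridB B m w i ^+ 4) (b i).
  by rewrite /b; case: cid2.
have bl i : b i <= Ce * (128 * h ^+ 2) by rewrite /b; case: cid2.
have hQ := has_mean_sum (fun i (_ : (i < N)%N) => bM i).
have hI := has_mean_add (has_mean_add (has_mean_indic P mH) (has_mean_indic P mJ))
  (has_mean_add (has_mean_cst P (-1)) (has_mean_scale (-1) (has_mean_indic P (mctl n%:R)))).
have hc := has_mean_cst P (- C * (2 * e) - ((L + 4 * `|M|) * e) * K - eta).
have hL := has_mean_add (has_mean_add (has_mean_scale (phi pi - phi 0) hI) hc)
  (has_mean_scale (-1) hQ).
have := has_mean_ae_le hL hR.
set sb := \sum_(0 <= i < N) b i.
have sbl : sb <= N%:R * (Ce * (128 * h ^+ 2)).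
  apply: (@le_trans _ _ (\sum_(0 <= i < N) Ce * (128 * h ^+ 2))).
    exact: ler_sum.
  by rewrite sumr_const_nat subn0 [leRHS]mulr_natl.
set rhs := (1 + M) * _ => H; refine (le_trans _ (H _)); first lra.
apply: filterS ae_good_path => w gw.
have := good_path_sum taylor psi_ge0 psi_lip phi_lip psi_cont phi_nd L0 C0 n m
    e0 e_pi K0 gw eta0 Ce0 young.
move=> G; apply: le_trans (le_trans G _).
  rewrite -/h; lra.
rewrite le_eqVlt; apply/orP; left; apply/eqP; apply: eq_bigr => i _.
rewrite /step_term indicE; have [wi|_] := boolP (w \in _); last by rewrite !mul0r.
have [Xi _] := controlled_in e0 gw (set_mem wi).
by rewrite /psi0 patchE mem_set.
Qed.

Lemma sum_ctl_le_mean_hitting :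
  ((\sum_(0 <= i < N) (h * p i) - h)%:E <= \int[P]_w hitting_time X pi w)%E.
Proof.
have hs := has_mean_sum (fun i (_ : (i < N)%N) => has_mean_scale h (has_mean_ctl i)).
apply: (ge0_integral_ge (has_mean_add hs (has_mean_cst P (- h)))).
  exact: hitting_time_ge0.
apply: filterS ae_good_path => w gw; apply: le_trans (good_path_count m K e0 gw N).
by rewrite lee_fin -mulr_sumr -/h; lra.
Qed.

Lemma survival_le_mean_hitting :
  ((n%:R * fine (P (ctl n%:R)))%:E <= \int[P]_w hitting_time X pi w)%E.
Proof.
have hs := has_mean_scale n%:R (has_mean_indic P (mctl n%:R)).
apply: (ge0_integral_ge hs); first exact: hitting_time_ge0.
by apply: filterS ae_good_path => w gw; exact: (good_path_survive n m K e0 gw).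
Qed.

End mean_inequality.

(** * Choice of the parameters *)

Section paths_on_segments.
Variable R : realType.

Lemma segment_unif_continuous (f : R -> R) (a b e : R) : 0 < e ->
  {within `[a, b], continuous f} ->
  exists k : nat, forall x y, x \in `[a, b] -> y \in `[a, b] ->
    `|x - y| <= k.+1%:R^-1 -> `|f x - f y| <= e.
Proof.
move=> e0 /subspace_continuousP cf.
have /compact_near_coveringP cov := @segment_compact R a b.
pose Q (k : nat) (x : R) := x \in `[a, b] -> forall y, y \in `[a, b] ->
  `|x - y| <= k.+1%:R^-1 -> `|f x - f y| <= e.
have [|N _ /(_ N (leqnn N)) H] := cov nat \oo Q _.
  move=> x xab; have e20 : 0 < e / 2 by rewrite divr_gt0.
  have /cvgrPdist_lt/(_ _ e20)/nbhs_ballP[d /= d0 Hd] := cf x xab.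
  have d20 : 0 < d / 2 by rewrite divr_gt0.
  exists (ball x (d / 2), [set k : nat | k.+1%:R^-1 < d / 2]) => /=.
    split; first exact: nbhsx_ballx.
    exact: near_infty_natSinv_lt (PosNum d20).
  move=> [x' k] /= [xx' kd] x'ab y yab x'y.
  have h1 := Hd x' _ x'ab; have h2 := Hd y _ yab.
  rewrite /ball /= in xx' h1 h2.
  have {}h1 : `|f x - f x'| < e / 2 by apply: h1; lra.
  have {}h2 : `|f x - f y| < e / 2.
    apply: h2; have := ler_distD x' x y.
    by have := le_lt_trans x'y kd; lra.
  by have := ler_distD (f x) (f x') (f y); rewrite (distrC (f x') (f x)); lra.
by exists N => x y xab; exact: (H x xab).
Qed.

Lemma segment_bounded (f : R -> R) (a b : R) : {within `[a, b], continuous f} ->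
  exists k : nat, forall x, x \in `[a, b] -> f x <= k%:R.
Proof.
move=> cf; have [ab|ba] := leP a b.
  have [c cab cmax] := EVT_max ab cf.
  exists (Num.truncn (Num.max 0 (f c))).+1 => x /cmax fx; apply: le_trans fx _.
  have := ltW (truncnS_gt (Num.max 0 (f c))); apply: le_trans.
  by rewrite le_max lexx orbT.
by exists 0%N => x; rewrite in_itv /= => /andP[ax xb]; lra.
Qed.

End paths_on_segments.

Section covers.
Variables (R : realType) (phi : R -> R).
Context (d : measure_display) (T : measurableType d) (P : probability T R).
Variables (F : R -> set (set T)) (B X : R -> T -> R).
Hypothesis X_diff : diffusion_from0 phi P F B X.
Variable n : nat.

Let within_segment (f : R -> R) : {within `[0, +oo[, continuous f} ->
  {within `[0, n%:R], continuous f}.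
Proof.
by apply: continuous_subspaceW => x /=; rewrite !in_itv /= => /andP[->].
Qed.

Lemma below_cover : {ae P, forall w, exists k : nat,
  below k%:R (drift_part B X) n%:R w}.
Proof.
apply: filterS (ae_good_path X_diff) => w [cX cB _ _ _].
have cW : {within `[0, n%:R], continuous (fun t => drift_part B X t w)}.
  apply: within_segment => t; apply: cvgB; first exact: cX.
  by apply: cvgM; [exact: cvg_cst|exact: cB].
have [k H] := segment_bounded cW; exists k => q q0n; apply: H.
by rewrite in_itv /=.
Qed.

Lemma small_osc_cover e : 0 < e -> {ae P, forall w, exists k : nat,
  (small_osc e k.+1%:R^-1 X n%:R `&` small_osc e k.+1%:R^-1 B n%:R) w}.
Proof.
move=> e0; apply: filterS (ae_good_path X_diff) => w [cX cB _ _ _].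
have [k Hk] := segment_unif_continuous e0 (within_segment cX).
have [l Hl] := segment_unif_continuous e0 (within_segment cB).
have le_inv i j : (i <= j)%N -> j.+1%:R^-1 <= i.+1%:R^-1 :> R.
  by move=> ij; rewrite lef_pV2 ?posrE// ler_nat.
exists (maxn k l); split => q r q0n r0n qr.
- apply: Hk; rewrite ?in_itv//=; apply: le_trans qr _.
  exact/le_inv/leq_maxl.
- apply: Hl; rewrite ?in_itv//=; apply: le_trans qr _.
  exact/le_inv/leq_maxr.
Qed.

End covers.

Lemma le_of_eps_approx (R : realType) (x y k : R) : 0 < k ->
  (forall e, 0 < e -> x <= y + e * k) -> x <= y.
Proof.
move=> k0 H; apply/ler_addgt0Pr => e e0.
by have := H (e / k) (divr_gt0 e0 k0); rewrite divfK// gt_eqF.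
Qed.

Lemma weighted_quartic_young (R : realType) (psi : R -> R) (Q : R -> Prop)
    (M Cpsi eta : R) : 0 < eta ->
  (forall x, Q x -> 0 <= psi x <= Cpsi) ->
  exists2 Ce, 0 <= Ce & forall x, Q x -> forall u,
    - (eta + Ce * u ^+ 4) <= psi x * (Num.sqrt 2 * u) + M * u ^+ 2.
Proof.
move=> eta0 psiB; have [Ce Ce0 H] := quartic_young (Cpsi * Num.sqrt 2) `|M| eta0.
exists Ce => // x /psiB/andP[p0 pC] u; have r0 : 0 <= Num.sqrt 2 :> R := sqrtr_ge0 _.
rewrite lerNl opprD; apply: le_trans (H u); apply: lerD.
- rewrite -mulrN; apply: le_trans (ler_norm _) _.
  rewrite normrM normrN normrM (ger0_norm p0) (ger0_norm r0) mulrA.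
  by rewrite ler_wpM2r// ler_wpM2r.
- apply: le_trans (ler_norm _) _.
  by rewrite normrN normrM (ger0_norm (sqr_ge0 u)).
Qed.

Theorem lemma16 (R : realType) (phi : R -> R)
    (phi_ge0 : forall x, x \in `[0, pi] -> 0 <= phi x)
    (phi_C2 : C2_on `[0, pi] phi)
    (phi_incr : {in `[0, pi] &, {homo phi : x y / x < y}})
    (dphi_gt0 : forall x, x \in `]0, pi[ -> 0 < deriv_on `[0, pi] phi x)
    (entrance0 : entrance_boundary0 phi)
    (M : R)
    (M_max : is_max_on `[0, pi] (deriv_on `[0, pi] (deriv_on `[0, pi] phi)) M)
    (M_gtN1 : -1 < M)
    (d : measure_display) (T : measurableType d) (P : probability T R)
    (F : R -> set (set T)) (B X : R -> T -> R)
    (X_diff : diffusion_from0 phi P F B X) :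
  (((phi pi - phi 0) / (1 + M))%:E <= \int[P]_w hitting_time X pi w)%E.
Proof.
have [dphi ddphi cddphi] := phi_C2; have [_ ddM] := M_max.
have pi0 : 0 < pi :> R := pi_gt0 R.
have psi_cont := derivable_on_continuous ddphi.
have [L L0 psi_lip] := deriv_on_lipschitz pi0 ddphi cddphi.
have [C C0 phi_lip] := deriv_on_lipschitz pi0 dphi psi_cont.
have psi_ge0 := ge0_of_lipschitz pi0 dphi_gt0 psi_lip.
have [z zA psi_le] := EVT_max (ltW pi0) psi_cont.
have taylor := second_order_bound dphi ddphi ddM.
have phi_nd x y : x \in `[0, pi] -> y \in `[0, pi] -> x <= y -> phi x <= phi y.
  by move=> xA yA; rewrite le_eqVlt => /predU1P[->//|xy]; exact/ltW/phi_incr.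
have M1 : 0 < 1 + M by rewrite -ltrBlDl sub0r.
set D := phi pi - phi 0.
have D0 : 0 <= D.
  by rewrite subr_ge0 phi_nd ?in_itv /= ?lexx ?(ltW pi0).
have tau0 : (0 <= \int[P]_w hitting_time X pi w)%E.
  by apply: integral_ge0 => w _; exact: hitting_time_ge0.
case tauE : (\int[P]_w hitting_time X pi w)%E tau0 => [mt||] // mt0; last exact: leey.
rewrite lee_fin ler_pdivrMr//; rewrite lee_fin in mt0.
apply: (@le_of_eps_approx _ _ _ (3 * D + 4 + (1 + M))) => [|eps eps0].
  by rewrite ltr_wpDl// addr_ge0// mulr_ge0.
have [Ce Ce0 young] := @weighted_quartic_young _ (deriv_on `[0, pi] phi)
  (fun x => x \in `[0, pi]) M (deriv_on `[0, pi] phi z) eps eps0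
  (fun x xA => introT andP (conj (psi_ge0 x xA) (psi_le x xA))).
(* The parameters are chosen in this order: the horizon [n] makes survival
   unlikely, [K] bounds the drift part with high probability, the tolerance
   [e] is small compared with [K], and the mesh is then fine enough for the
   oscillations to be below [e] with high probability. *)
pose n := (Num.truncn (mt / eps)).+1.
have n_big : mt <= eps * n%:R.
  by rewrite mulrC -ler_pdivrMr//; exact/ltW/truncnS_gt.
have mX t : 0 <= t -> measurable_fun setT (X t).
  have [[fF _ _ _ _] aX _ _ _] := X_diff.
  by move=> t0; apply: (adapted_at_measurable fF t0) => S; exact: aX.
have mB t : 0 <= t -> measurable_fun setT (B t).
  have [[fF aB _ _ _] _ _ _ _] := X_diff.
  by move=> t0; apply: (adapted_at_measurable fF t0) => S; exact: aB.
have [k Pk] : exists k : nat, 1 - eps <= fine (P (below k%:R (drift_part B X) n%:R)).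
  apply: probability_increasing_cover => //; last exact: below_cover X_diff _.
  - move=> k; apply: measurable_below => s s0 _.
    apply: measurable_funB; first exact: mX.
    by apply: measurable_funM => //; exact: mB.
  - move=> i j ij w bw q q0n; apply: le_trans (bw q q0n) _.
    by rewrite ler_nat.
set K := k%:R : R in Pk.
have K0 : 0 <= K by rewrite ler0n.
have kap0 : 0 <= (L + 4 * `|M|) * K by rewrite mulr_ge0// addr_ge0// mulr_ge0.
pose e := Num.min pi (Num.min (eps / (2 * C + 1)) (eps / ((L + 4 * `|M|) * K + 1))).
have c1 : 0 < 2 * C + 1 by rewrite ltr_wpDl// mulr_ge0.
have c2 : 0 < (L + 4 * `|M|) * K + 1 by rewrite ltr_wpDl.
have e0 : 0 < e by rewrite !lt_min pi0 !divr_gt0.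
have e_pi : e <= pi by rewrite ge_min lexx.
have eC : C * (2 * e) <= eps.
  have : e * (2 * C + 1) <= eps by rewrite -ler_pdivlMr// !ge_min lexx !orbT.
  lra.
have eK : (L + 4 * `|M|) * e * K <= eps.
  have : e * ((L + 4 * `|M|) * K + 1) <= eps.
    by rewrite -ler_pdivlMr// !ge_min lexx !orbT.
  lra.
pose J l := small_osc e l.+1%:R^-1 X n%:R `&` small_osc e l.+1%:R^-1 B n%:R.
have invS_le i j : (i <= j)%N -> j.+1%:R^-1 <= i.+1%:R^-1 :> R.
  by move=> ij; rewrite lef_pV2 ?posrE// ler_nat.
have mJ l : measurable (J l).
  by apply: measurableI; apply: measurable_small_osc => s s0 _; [exact: mX|exact: mB].
have J_incr i j : (i <= j)%N -> J i `<=` J j.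
  move=> ij w [oX oB]; split=> q r q0 r0 qr.
  - by apply: oX => //; exact: le_trans qr (invS_le _ _ ij).
  - by apply: oB => //; exact: le_trans qr (invS_le _ _ ij).
have [l Pl] := probability_increasing_cover eps0 mJ J_incr (small_osc_cover X_diff n e0).
(* [128] bounds the fourth moment of a standard Gaussian *)
pose b := n%:R * Ce * 128 + 1.
have b0 : 0 < b by rewrite ltr_wpDl// !mulr_ge0.
pose m := maxn l (Num.truncn (b / eps)).
have PJ : 1 - eps <= fine (P (J m)).
  apply: le_trans Pl _; apply: fine_le; rewrite ?fin_num_measure//.
  by apply: le_measure; rewrite ?inE//; apply/J_incr/leq_maxl.
set h := m.+1%:R^-1 : R.
have h0 : 0 < h by rewrite invr_gt0.
have hb : h * b <= eps.
  rewrite mulrC ler_pdivrMr// mulrC -ler_pdivrMr//.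
  apply: le_trans (ltW (truncnS_gt _)) _.
  by rewrite ler_nat ltnS leq_maxr.
have b1 : 1 <= b by rewrite lerDr !mulr_ge0.
have h_eps : h <= eps by have := ler_wpM2l (ltW h0) b1; lra.
have quartic : (n * m.+1)%:R * (Ce * (128 * h ^+ 2)) <= eps.
  have hm : m.+1%:R * h = 1 by rewrite divff// pnatr_eq0.
  rewrite natrM (_ : _ * _ * _ = (m.+1%:R * h) * (h * (n%:R * Ce * 128))); last by ring.
  by rewrite hm mul1r; move: hb; rewrite /b; lra.
have main := mean_inequality taylor psi_ge0 psi_le psi_lip phi_lip psi_cont
  phi_nd L0 C0 X_diff n m e0 e_pi K0 (ltW eps0) Ce0 young.
have dur := sum_ctl_le_mean_hitting X_diff n m K e0.
have surv := survival_le_mean_hitting X_diff n m K e0.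
rewrite tauE lee_fin -/h in dur; rewrite tauE lee_fin in surv.
set pG := fine _ in surv.
have n0 : 0 < n%:R :> R by rewrite ltr0n.
have pG_eps : pG <= eps.
  by rewrite -(ler_pM2l n0) (le_trans surv)// mulrC.
move: main; rewrite -/h -/D -/pG; set S := \sum_(0 <= i < _) _ in dur *.
set pH := fine _ in Pk *; set pJ := fine _ in PJ *; move=> main.
have h1 : D * (1 - 3 * eps) <= D * (pH + pJ - 1 - pG).
  by rewrite ler_wpM2l//; lra.
have h2 : (1 + M) * S <= (1 + M) * (mt + eps).
  by rewrite ler_wpM2l ?(ltW M1)//; lra.
lra.
Qed.
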